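(* Let $\mathcal{H}=L^2(\mathbb{R}^\times,dt/|t|)$ and let $T_1,T_2\in\mathcal{S}_1(\mathcal{H})=\mathcal{H}\widehat{\otimes}\overline{\mathcal{H}}$. Then for a.e. $(s,t)\in\mathbb{R}^\times\times\mathbb{R}^\times$, $$(T_1\boxtimes T_2)(s,t)=\int_{-\infty}^{\infty}T_1\Bigl(\frac{s}{1+h},\frac{t}{1+h}\Bigr)T_2\Bigl(\frac{hs}{1+h},\frac{ht}{1+h}\Bigr)\frac{dh}{|h|}=\int_{-\infty}^{\infty}T_1((1-u)s,(1-u)t)\,T_2(us,ut)\,\frac{du}{|1-u|\,|u|},$$ where both of the integrals are absolutely convergent for a.e. $(s,t)\in\mathbb{R}^\times\times\mathbb{R}^\times$.
   Context: $\mathbb{R}^\times$ is the multiplicative group of non-zero reals with Haar measure $dt/|t|$; $\mathcal{H}=L^2(\mathbb{R}^\times,dt/|t|)$, with inner product linear in the first variable. $\overline{\mathcal{H}}$ is the conjugate Hilbert space; $\mathcal{H}\widehat{\otimes}\overline{\mathcal{H}}$ (projective tensor product) is identified with the trace-class operators $\mathcal{S}_1(\mathcal{H})$, with $\xi\otimes\eta$ corresponding to $\alpha\mapsto\langle\alpha,\eta\rangle\xi$. For $r\in\mathbb{R}^\times$, $(\lambda(r)\xi)(t)=\xi(r^{-1}t)$, and $f\cdot g$ is the pointwise product. Dual convolution $\boxtimes$ is the unique contractive bilinear map $\mathcal{S}_1(\mathcal{H})\times\mathcal{S}_1(\mathcal{H})\to\mathcal{S}_1(\mathcal{H})$ satisfying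 $$(\xi\otimes\eta)\boxtimes(\xi'\otimes\eta')=\int_{\mathbb{R}^\times}\bigl(\lambda(1+h)\xi\cdot\lambda(1+h^{-1})\xi'\bigr)\otimes\bigl(\lambda(1+h)\eta\cdot\lambda(1+h^{-1})\eta'\bigr)\,\frac{dh}{|h|}$$ (a Bochner integral in $\mathcal{H}\widehat{\otimes}\overline{\mathcal{H}}$). Each $T\in\mathcal{S}_1(\mathcal{H})$ is viewed, up to a.e. equality, as a function in $L^2(\mathbb{R}^\times\times\mathbb{R}^\times,|s|^{-1}|t|^{-1}d(s,t))$, namely its integral kernel: $\langle T\alpha,\beta\rangle=\int_{\mathbb{R}^\times\times\mathbb{R}^\times}\overline{\beta(s)}\,T(s,t)\,\alpha(t)\,\frac{d(s,t)}{|s||t|}$ for $\alpha,\beta\in\mathcal{H}$. In particular, if $T=\xi\otimes\eta$ then $T(s,t)=\xi(s)\overline{\eta(t)}$. Functions on $\mathbb{R}^\times$ are regarded as a.e.-defined functions on $\mathbb{R}$. *)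

(* Defs.v *)
From HB Require Import structures.
From mathcomp Require Import all_boot all_order all_algebra.
From mathcomp Require Import ring_quotient.
From mathcomp Require Import all_classical all_reals all_analysis.
From mathcomp Require Import measurable_realfun.
From mathcomp Require Import complex ring.
Set Implicit Arguments.
Unset Strict Implicit.
Unset Printing Implicit Defensive.
Import Order.TTheory GRing.Theory Num.Theory.
Import numFieldNormedType.Exports.
Local Open Scope classical_set_scope.
Local Open Scope ring_scope.
Local Open Scope quotient_scope.
Local Open Scope complex_scope.

Notation normc := Normc.normc.

Section ComplexIntegral.
Context d (T : measurableType d) (R : realType).
Implicit Type f : T -> R[i].

Definition cmeasurable f :=
  measurable_fun setT (fun x => complex.Re (f x)) /\
  measurable_fun setT (fun x => complex.Im (f x)).

Variable mu : {measure set T -> \bar R}.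

Definition cintegrable f :=
  cmeasurable f /\ (\int[mu]_x (normc (f x))%:E < +oo)%E.

Definition cintegral f : R[i] :=
  (\int[mu]_x complex.Re (f x)) +i* (\int[mu]_x complex.Im (f x)).

Definition square_integrable f :=
  cmeasurable f /\ (\int[mu]_x (normc (f x) ^+ 2)%:E < +oo)%E.

End ComplexIntegral.

Section L2.
Context d (T : measurableType d) (R : realType).
Variable mu : {measure set T -> \bar R}.
Local Notation C := R[i].
Implicit Types f g : T -> C.

Let sqrD (a b : C) : normc (a + b) ^+ 2 <= 2 * normc a ^+ 2 + 2 * normc b ^+ 2.
Proof.
case: a b => [a1 a2] [b1 b2] /=.
rewrite !sqr_sqrtr ?addr_ge0 ?sqr_ge0// -subr_ge0.
suff -> : 2 * (a1 ^+ 2 + a2 ^+ 2) + 2 * (b1 ^+ 2 + b2 ^+ 2) -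
  ((a1 + b1) ^+ 2 + (a2 + b2) ^+ 2) = (a1 - b1) ^+ 2 + (a2 - b2) ^+ 2.
  by rewrite addr_ge0 ?sqr_ge0.
by ring.
Qed.

Lemma cmeasurableD f g : cmeasurable f -> cmeasurable g ->
  cmeasurable (fun x => f x + g x).
Proof.
move=> [mf1 mf2] [mg1 mg2]; split.
  rewrite (_ : (fun _ => _) =
    (fun x => complex.Re (f x)) \+ (fun x => complex.Re (g x))).
    exact: measurable_funD.
  by apply/funext => x /=; case: (f x) => ??; case: (g x).
rewrite (_ : (fun _ => _) =
  (fun x => complex.Im (f x)) \+ (fun x => complex.Im (g x))).
  exact: measurable_funD.
by apply/funext => x /=; case: (f x) => ??; case: (g x).
Qed.

Lemma cmeasurableZ (a : C) f : cmeasurable f -> cmeasurable (fun x => a * f x).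
Proof.
move=> [mf1 mf2]; case: a => a b; split.
  rewrite (_ : (fun _ => _) = (fun x => a * complex.Re (f x)) \-
    (fun x => b * complex.Im (f x))).
    by apply: measurable_funB; apply: measurable_funM.
  by apply/funext => x /=; case: (f x).
rewrite (_ : (fun _ => _) = (fun x => a * complex.Im (f x)) \+
    (fun x => b * complex.Re (f x))).
  by apply: measurable_funD; apply: measurable_funM.
by apply/funext => x /=; case: (f x).
Qed.

Lemma measurable_normc2 f : cmeasurable f ->
  measurable_fun setT (fun x => normc (f x) ^+ 2).
Proof.
move=> [mf1 mf2].
rewrite (_ : (fun _ => _) = (fun x => complex.Re (f x) ^+ 2) \+
    (fun x => complex.Im (f x) ^+ 2)).
  by apply: measurable_funD; apply: measurable_funX.
apply/funext => x /=; case: (f x) => a b /=.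
by rewrite sqr_sqrtr// addr_ge0 ?sqr_ge0.
Qed.

Lemma integral_normc2D f g : cmeasurable f -> cmeasurable g ->
  (\int[mu]_x (normc (f x + g x) ^+ 2)%:E <=
   2%:E * \int[mu]_x (normc (f x) ^+ 2)%:E +
   2%:E * \int[mu]_x (normc (g x) ^+ 2)%:E)%E.
Proof.
move=> mf mg.
have mf2 := measurable_normc2 mf; have mg2 := measurable_normc2 mg.
have mfg2 := measurable_normc2 (cmeasurableD mf mg).
rewrite -!ge0_integralZl//=; last 4 first.
- by apply/measurable_EFinP.
- by move=> x _; rewrite lee_fin sqr_ge0.
- by apply/measurable_EFinP.
- by move=> x _; rewrite lee_fin sqr_ge0.
rewrite -ge0_integralD//=; last 4 first.
- by move=> x _; rewrite mule_ge0// lee_fin sqr_ge0.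
- by apply: emeasurable_funM => //; apply/measurable_EFinP.
- by move=> x _; rewrite mule_ge0// lee_fin sqr_ge0.
- by apply: emeasurable_funM => //; apply/measurable_EFinP.
apply: ge0_le_integral => //=.
- by move=> x _; rewrite lee_fin sqr_ge0.
- by apply/measurable_EFinP.
- by apply: emeasurable_funD; apply: emeasurable_funM => //;
    apply/measurable_EFinP.
by move=> x _; rewrite -!EFinM -EFinD lee_fin sqrD.
Qed.

Lemma integral_normc2Z (a : C) f : cmeasurable f ->
  (\int[mu]_x (normc (a * f x) ^+ 2)%:E =
   (normc a ^+ 2)%:E * \int[mu]_x (normc (f x) ^+ 2)%:E)%E.
Proof.
move=> mf; have mf2 := measurable_normc2 mf.
rewrite -ge0_integralZl//=; last 3 first.
- by apply/measurable_EFinP.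
- by move=> x _; rewrite lee_fin sqr_ge0.
- by rewrite lee_fin sqr_ge0.
by apply: eq_integral => x _; rewrite Normc.normcM exprMn EFinM.
Qed.

Definition L2pred : {pred T -> C} := fun f => `[< square_integrable mu f >].

Lemma L2predP f : reflect (square_integrable mu f) (f \in L2pred).
Proof. exact: asboolP. Qed.

Lemma L2pred_submod_closed : submod_closed L2pred.
Proof.
split.
  apply/L2predP; split; first by split; exact: measurable_cst.
  rewrite (_ : (fun _ => _) = cst 0%E) ?integral0 ?ltry//.
  by apply/funext => x /=; rewrite expr0n/= addr0 sqrtr0 expr0n.
move=> a f g /L2predP [mf f2] /L2predP [mg g2]; apply/L2predP.
have maf := cmeasurableZ a mf; split; first exact: cmeasurableD.
apply: (le_lt_trans (integral_normc2D maf mg)).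
rewrite integral_normc2Z//.
apply: lte_add_pinfty; apply: lte_mul_pinfty => //; rewrite ?lee_fin//.
apply: lte_mul_pinfty => //; by rewrite lee_fin sqr_ge0.
Qed.

HB.instance Definition _ :=
  GRing.isSubmodClosed.Build C (T -> C) L2pred L2pred_submod_closed.

Record L2fun := MkL2fun { l2fun :> T -> C ; l2funP : l2fun \in L2pred }.

HB.instance Definition _ := [isSub for l2fun].
HB.instance Definition _ := [Choice of L2fun by <:].
HB.instance Definition _ := [SubChoice_isSubLmodule of L2fun by <:].

Definition null_L2fun : {pred L2fun} :=
  fun f : L2fun => `[< {ae mu, forall t, f t = 0} >].

Lemma null_L2fun_submod_closed : submod_closed null_L2fun.
Proof.
split; first by apply/asboolP/nearW.
move=> a f g /asboolP f0 /asboolP g0; apply/asboolP.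
apply: filterS2 f0 g0 => t ft0 gt0.
by rewrite -[LHS]/(a * f t + g t) ft0 gt0 mulr0 addr0.
Qed.

HB.instance Definition _ :=
  GRing.isSubmodClosed.Build C L2fun null_L2fun null_L2fun_submod_closed.

Definition L2 : Type := Quotient.quot null_L2fun.
HB.instance Definition _ := GRing.Zmodule.on L2.
HB.instance Definition _ := ZmodQuotient.on L2.

Definition L2_scale (a : C) (x : L2) : L2 := \pi_L2 (a *: repr x).

Lemma pi_L2_scale a (f : L2fun) : \pi_L2 (a *: f) = L2_scale a (\pi_L2 f).
Proof.
apply/eqP; rewrite -Quotient.idealrBE -scalerBr rpredZ//.
by rewrite Quotient.idealrBE reprK.
Qed.

Let L2_scaleA a b x : L2_scale a (L2_scale b x) = L2_scale (a * b) x.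
Proof.
elim/quotW: x => f.
by rewrite -(pi_L2_scale b f) -(pi_L2_scale a (b *: f)) -(pi_L2_scale _ f)
  scalerA.
Qed.

Let L2_scale1 : left_id 1 L2_scale.
Proof. by elim/quotW => f; rewrite -(pi_L2_scale _ f) scale1r. Qed.

Let L2_scaleDr : right_distributive L2_scale +%R.
Proof.
move=> a; elim/quotW => f; elim/quotW => g.
rewrite -pi_addr -(pi_L2_scale a (f + g)) -(pi_L2_scale a f) -(pi_L2_scale a g).
by rewrite -pi_addr scalerDr.
Qed.

Let L2_scaleDl x : {morph L2_scale^~ x : a b / a + b}.
Proof.
elim/quotW: x => f a b.
by rewrite -(pi_L2_scale a f) -(pi_L2_scale b f) -(pi_L2_scale _ f) -pi_addr scalerDl.
Qed.

HB.instance Definition _ := GRing.Zmodule_isLmodule.Build C L2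
  L2_scaleA L2_scale1 L2_scaleDr L2_scaleDl.

Definition L2_to_fun (x : L2) : T -> C := repr x : L2fun.
Coercion L2_to_fun : L2 >-> Funclass.

(* The class of f when f is square integrable, and 0 otherwise. *)
Definition L2_of (f : T -> C) : L2 := \pi_L2 (insubd (0 : L2fun) f).

Definition L2_inner (x y : L2) : C := cintegral mu (fun t => x t * (y t)^*).

Definition L2_norm (x : L2) : R :=
  Num.sqrt (\int[mu]_t (normc (x t) ^+ 2)).

Lemma pi_L2_ae (f : L2fun) : {ae mu, forall t, (\pi_L2 f : L2) t = f t}.
Proof.
have : repr (\pi_L2 f) - f \in null_L2fun.
  by rewrite Quotient.idealrBE reprK.
move=> /asboolP; apply: filterS => t ft; apply/eqP; rewrite -subr_eq0.
exact/eqP.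
Qed.

Lemma L2_addE (x y : L2) : {ae mu, forall t, (x + y : L2) t = x t + y t}.
Proof.
have -> : x + y = \pi_L2 (repr x + repr y) by rewrite pi_addr !reprK.
exact: pi_L2_ae.
Qed.

Lemma L2_scaleE (a : C) (x : L2) : {ae mu, forall t, (a *: x : L2) t = a * x t}.
Proof. exact: (pi_L2_ae (a *: repr x)). Qed.

Lemma cmeasurable_L2 (x : L2) : cmeasurable x.
Proof. by have /L2predP[] := l2funP (repr x). Qed.

Lemma L2_fin (x : L2) : (\int[mu]_t (normc (x t) ^+ 2)%:E < +oo)%E.
Proof. by have /L2predP[] := l2funP (repr x). Qed.

Lemma L2_norm_sqr (x : L2) :
  ((L2_norm x ^+ 2)%:E = \int[mu]_t (normc (x t) ^+ 2)%:E)%E.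
Proof.
rewrite sqr_sqrtr; last by apply: Rintegral_ge0 => t _; exact: sqr_ge0.
rewrite /Rintegral fineK// ge0_fin_numE ?L2_fin//.
by apply: integral_ge0 => t _; rewrite lee_fin sqr_ge0.
Qed.

Lemma L2_norm_ge0 x : 0 <= L2_norm x. Proof. exact: sqrtr_ge0. Qed.

Lemma L2_norm_sqr_ae (x : L2) f : cmeasurable f ->
  {ae mu, forall t, x t = f t} ->
  ((L2_norm x ^+ 2)%:E = \int[mu]_t (normc (f t) ^+ 2)%:E)%E.
Proof.
move=> mf xf; rewrite L2_norm_sqr; apply: ge0_ae_eq_integral => //=.
- by apply/measurable_EFinP/measurable_normc2/cmeasurable_L2.
- by apply/measurable_EFinP/measurable_normc2.
- by move=> t _; rewrite lee_fin sqr_ge0.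
- by move=> t _; rewrite lee_fin sqr_ge0.
- by apply: filterS xf => t /= -> _.
Qed.

Lemma L2_normZ (a : C) x : L2_norm (a *: x) = normc a * L2_norm x.
Proof.
have normc_ge0 : 0 <= normc a by case: a => ? ?; exact: sqrtr_ge0.
apply/eqP; rewrite -(@eqrXn2 _ 2) ?L2_norm_ge0 ?mulr_ge0 ?L2_norm_ge0//.
rewrite exprMn -eqe [X in _ == X]EFinM [X in (_ * X)%E]L2_norm_sqr.
rewrite -integral_normc2Z; last exact: cmeasurable_L2.
by rewrite (L2_norm_sqr_ae _ (L2_scaleE a x))//;
  exact/cmeasurableZ/cmeasurable_L2.
Qed.

Lemma L2_norm0 : L2_norm 0 = 0.
Proof. by rewrite -(scale0r (0 : L2)) L2_normZ Normc.normc0 mul0r. Qed.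

Lemma L2_normD_le (x y : L2) :
  L2_norm (x + y) <= 2 * (L2_norm x + L2_norm y).
Proof.
have mx := cmeasurable_L2 x; have my := cmeasurable_L2 y.
rewrite -(@ler_pXn2r _ 2) ?nnegrE ?mulr_ge0 ?addr_ge0 ?L2_norm_ge0//.
rewrite -lee_fin (L2_norm_sqr_ae (cmeasurableD mx my) (L2_addE x y)).
apply: (le_trans (integral_normc2D mx my)).
rewrite -!L2_norm_sqr -!EFinM -EFinD lee_fin.
have := L2_norm_ge0 x; have := L2_norm_ge0 y.
move: (L2_norm x) (L2_norm y) => u v v0 u0.
rewrite -subr_ge0 (_ : _ - _ = 2 * (u ^+ 2 + v ^+ 2) + 8 * (u * v)); last by ring.
by rewrite addr_ge0 ?mulr_ge0 ?addr_ge0 ?sqr_ge0.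
Qed.

Definition rank_one (x y : L2) : L2 -> L2 := fun a => L2_inner a y *: x.

(* The projective tensor product of the Hilbert space with its conjugate,
   realised as the trace-class operators: its elements are the sums of the
   series of rank-one operators xi_n (x) eta_n such that the series of the
   |xi_n| |eta_n| converges, and its norm is the infimum of the sums of
   |xi_n| |eta_n| over all such representations. *)
Definition nuclear_series (A : L2 -> L2) (xi eta : nat -> L2) :=
  cvgn (series (fun n => L2_norm (xi n) * L2_norm (eta n))) /\
  forall a : L2,
    L2_norm (A a - \sum_(k < n) rank_one (xi k) (eta k) a) @[n --> \oo] --> 0.

Definition trace_class_pred : {pred L2 -> L2} :=
  fun A => `[< exists xi eta, nuclear_series A xi eta >].

Let interleave (V : Type) (u v : nat -> V) (k : nat) : V :=
  if odd k then v k./2 else u k./2.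

Let sum_interleave (V : zmodType) (u v : nat -> V) n :
  \sum_(k < n) interleave u v k =
  \sum_(k < uphalf n) u k + \sum_(k < n./2) v k.
Proof.
elim: n => [|n IHn]; first by rewrite !big_ord0 addr0.
rewrite big_ord_recr/= IHn /interleave uphalf_half.
case: ifPn => on; rewrite ?add0n ?add1n.
  by rewrite [X in _ = _ + X]big_ord_recr/= addrA.
by rewrite [X in _ = X + _]big_ord_recr/= addrAC.
Qed.

Let cvg_half (u : R^nat) (l : R) : u @ \oo --> l -> u n./2 @[n --> \oo] --> l.
Proof.
move=> ul; apply: (cvg_comp _ _ _ ul) => A [N _ NA].
exists N.*2 => // n /=; rewrite -geq_half_double => Nn; exact: NA.
Qed.

Let cvg_uphalf (u : R^nat) (l : R) :
  u @ \oo --> l -> u (uphalf n) @[n --> \oo] --> l.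
Proof.
move=> ul; apply: (cvg_comp _ _ _ ul) => A [N _ NA].
exists N.*2 => // n /=; rewrite -geq_half_double => Nn; apply: NA => /=.
by rewrite uphalf_half (leq_trans Nn)// leq_addl.
Qed.

Lemma trace_class_submod_closed : submod_closed trace_class_pred.
Proof.
split.
  apply/asboolP; exists (fun=> 0), (fun=> 0); split.
    rewrite (_ : series _ = cst 0); first exact: is_cvg_cst.
    by apply/funext => n; rewrite /series/= big1// => i _; rewrite L2_norm0 mul0r.
  move=> a; rewrite (_ : (fun _ => _) = cst 0); first exact: cvg_cst.
  apply/funext => n; rewrite big1 ?subr0 ?L2_norm0//.
  by move=> i _; rewrite /rank_one scaler0.
move=> a f g /asboolP[xi [eta [cu fu]]] /asboolP[xi' [eta' [cv gv]]].
apply/asboolP; exists (interleave (fun k => a *: xi k) xi'), (interleave eta eta').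
split.
  pose u k := L2_norm (a *: xi k) * L2_norm (eta k).
  pose v k := L2_norm (xi' k) * L2_norm (eta' k).
  rewrite (_ : series _ = fun n => series u (uphalf n) + series v n./2); last first.
    apply/funext => n; rewrite /series/= !big_mkord -sum_interleave.
    by apply: eq_bigr => k _; rewrite /interleave; case: ifP.
  apply: is_cvgD; apply/cvg_ex.
    have : cvgn (series u).
      rewrite (_ : series u = (fun n => normc a *
          series (fun n => L2_norm (xi n) * L2_norm (eta n)) n)).
        exact: is_cvgMr.
      apply/funext => n; rewrite /series/= mulr_sumr.
      by apply: eq_bigr => k _; rewrite /u L2_normZ mulrA.
    by move=> /cvg_ex[l ul]; exists l; exact: cvg_uphalf.
  by move/cvg_ex: cv => [l vl]; exists l; exact: cvg_half.
move=> x.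
pose e n := L2_norm (f x - \sum_(k < n) rank_one (xi k) (eta k) x).
pose e' n := L2_norm (g x - \sum_(k < n) rank_one (xi' k) (eta' k) x).
apply: (@squeeze_cvgr _ _ _ _ (cst 0)
    (fun n => 2 * (normc a * e (uphalf n) + e' n./2))).
- apply: nearW => n; rewrite L2_norm_ge0/=.
  rewrite (eq_bigr (fun k : 'I_n => interleave
    (fun k => a *: rank_one (xi k) (eta k) x)
    (fun k => rank_one (xi' k) (eta' k) x) k)); last first.
    move=> k _; rewrite /interleave; case: ifP => // _.
    by rewrite /rank_one !scalerA mulrC.
  rewrite sum_interleave -scaler_sumr opprD.
  rewrite -[(a *: f + g) x]/(a *: f x + g x) addrACA -scalerBr.
  by rewrite (le_trans (L2_normD_le _ _))// L2_normZ.
- exact: cvg_cst.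
- rewrite [X in _ --> X](_ : _ = 2 * (normc a * 0 + 0)); last by rewrite mulr0 addr0 mulr0.
  apply: cvgMr; apply: cvgD; last exact: (cvg_half (gv x)).
  by apply: cvgMr; exact: (cvg_uphalf (fu x)).
Qed.

HB.instance Definition _ := GRing.isSubmodClosed.Build C (L2 -> L2)
  trace_class_pred trace_class_submod_closed.

Record trace_class := MkTraceClass {
  trace_class_op :> L2 -> L2 ;
  trace_classP : trace_class_op \in trace_class_pred }.

HB.instance Definition _ := [isSub for trace_class_op].
HB.instance Definition _ := [Choice of trace_class by <:].
HB.instance Definition _ := [SubChoice_isSubLmodule of trace_class by <:].

Definition trace_norm (A : trace_class) : R :=
  inf [set limn (series (fun n => L2_norm (p.1 n) * L2_norm (p.2 n))) |
    p in [set p : (nat -> L2) * (nat -> L2) | nuclear_series A p.1 p.2]].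

Lemma rank_one_trace_class x y : rank_one x y \in trace_class_pred.
Proof.
apply/asboolP; exists (fun k => if k is 0%N then x else 0), (fun=> y); split.
  apply/cvg_ex; exists (L2_norm x * L2_norm y).
  rewrite -cvg_shiftS (_ : (fun _ => _) = cst (L2_norm x * L2_norm y)).
    exact: cvg_cst.
  apply/funext => n; rewrite /series/= big_nat_recl//= big1 ?addr0//.
  by move=> i _; rewrite L2_norm0 mul0r.
move=> a; rewrite -cvg_shiftS (_ : (fun _ => _) = cst 0); first exact: cvg_cst.
apply/funext => n; rewrite big_ord_recl/= big1 ?addr0 ?subrr ?L2_norm0//.
by move=> i _; rewrite /rank_one scaler0.
Qed.

Definition tensor (x y : L2) : trace_class :=
  MkTraceClass (rank_one_trace_class x y).

End L2.

Section Bochner.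
Context d (T : measurableType d) (R : realType).
Variable mu : {measure set T -> \bar R}.
Variables (V : lmodType R[i]) (N : V -> R).

Definition step_function (s : seq (set T * V)) :=
  forall p, p \in s -> measurable p.1 /\ (mu p.1 < +oo)%E.

Definition step_value (s : seq (set T * V)) (x : T) : V :=
  \sum_(p <- s) (\1_(p.1) x)%:C *: p.2.

Definition step_integral (s : seq (set T * V)) : V :=
  \sum_(p <- s) (fine (mu p.1))%:C *: p.2.

(* F may be modified on a null set.  V need not be a normedModType: only the
   function N is used as its norm. *)
Definition is_bochner_integral (F : T -> V) (v : V) :=
  exists s : nat -> seq (set T * V),
    [/\ forall n, step_function (s n),
        {ae mu, forall x, N (F x - step_value (s n) x) @[n --> \oo] --> 0},
        (\int[mu]_x (N (F x - step_value (s n) x))%:E)%E @[n --> \oo] --> 0%E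
      & N (v - step_integral (s n)) @[n --> \oo] --> 0].

End Bochner.

Section Haar.
Variable R : realType.
Local Notation RR := (measurableTypeR R).

(* The Haar measure dt/|t| of the nonzero reals, as a measure on R; the point 0
   has measure zero (and 0^-1 = 0). *)
Definition haar : set RR -> \bar R :=
 fun A => (\int[lebesgue_measure]_(t in A) (`|t|^-1)%:E)%E.

Let haar0 : haar set0 = 0%E.
Proof. by rewrite /haar integral_set0. Qed.

Let haar_ge0 A : (0 <= haar A)%E.
Proof. by apply: integral_ge0 => t _; rewrite lee_fin invr_ge0. Qed.

Let mhaar (A : set RR) : measurable_fun A (fun t : RR => `|t|^-1).
Proof.
rewrite (_ : (fun _ => _) = (fun t : RR => `|t| `^ (-1))); last first.
  by apply/funext => t; rewrite powR_inv1.
apply: (measurableT_comp (measurable_powR (-1))).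
exact: normr_measurable.
Qed.

Let haar_sigma_additive : semi_sigma_additive haar.
Proof.
move=> /= A mA tA mUA.
rewrite /haar ge0_integral_bigcup//=.
  apply: is_cvg_ereal_nneg_natsum_cond => n _ _.
  exact: haar_ge0.
by apply/measurable_EFinP.
Qed.

HB.instance Definition _ := isMeasure.Build _ _ _ haar
  haar0 haar_ge0 haar_sigma_additive.

Let haar_sigma_finite : sigma_finite setT haar.
Proof.
pose F n : set RR := `[- n%:R, n%:R] `&`
  (fun t : RR => `|t|^-1) @^-1` `]-oo, n%:R].
have mF n : measurable (F n).
  apply: measurableI => //; rewrite -[X in measurable X]setTI; exact: mhaar.
exists F.
  rewrite eqEsubset; split => // t _.
  exists (Num.trunc `|t| + Num.trunc `|t|^-1).+1 => //; split => /=; last first.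
    rewrite in_itv/= ltW// (lt_le_trans (truncnS_gt _))// ler_nat ltnS leq_addl//.
  rewrite in_itv/= -ler_norml ltW// (lt_le_trans (truncnS_gt _))//.
  by rewrite ler_nat ltnS leq_addr.
move=> n; split => //.
apply: (@le_lt_trans _ _ (\int[lebesgue_measure]_(t in F n) (cst (n%:R)%:E t))%E).
  apply: ge0_le_integral => //.
  - by apply/measurable_EFinP.
  - by move=> t [_ /=]; rewrite in_itv/= lee_fin.
rewrite integral_cst//= lte_mul_pinfty//.
apply: (@le_lt_trans _ _ (lebesgue_measure (`[- n%:R, n%:R] : set RR))).
  by apply: le_measure; rewrite ?inE//; exact: subIsetl.
by rewrite lebesgue_measure_itv/=; case: ifP => // _; rewrite -EFinB ltry.
Qed.

HB.instance Definition _ := Measure_isSigmaFinite.Build _ _ _ haar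
  haar_sigma_finite.

End Haar.
Arguments haar : clear implicits.

Notation L2Rx R := (L2 (haar R)).
Notation S1 R := (trace_class (haar R)).

Section DualConvolution.
Variable R : realType.
Local Notation RR := (measurableTypeR R).
Local Notation C := R[i].

Definition translation (r : R) (x : L2Rx R) : L2Rx R :=
  L2_of (haar R) (fun t : RR => x (r^-1 * t)).

(* For given x and y this product is square integrable for almost every h
   only; L2_of gives 0 for the other values of h. *)
Definition dual_product (h : R) (x y : L2Rx R) : L2Rx R :=
  L2_of (haar R) (fun t => translation (1 + h) x t * translation (1 + h^-1) y t).

Definition dual_convolution (box : {bilinear S1 R -> S1 R -> S1 R}) :=
  (forall A B, trace_norm (box A B) <= trace_norm A * trace_norm B) /\
  (forall x y x' y' : L2Rx R,
     is_bochner_integral (haar R) (@trace_norm _ _ _ (haar R))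
       (fun h => tensor (dual_product h x x') (dual_product h y y'))
       (box (tensor x y) (tensor x' y'))).

(* K is any Borel representative of the integral kernel of A. *)
Definition is_kernel (A : S1 R) (K : RR * RR -> C) :=
  square_integrable (haar R \x haar R)%E K /\
  (forall a b : L2Rx R, L2_inner (A a) b =
     cintegral (haar R \x haar R)%E (fun p => (b p.1)^* * K p * a p.2)).

End DualConvolution.

(* Main.v *)
From HB Require Import structures.
Require Import Defs.
From mathcomp Require Import all_boot all_order all_algebra.
From mathcomp Require Import all_classical all_reals all_analysis.
From mathcomp Require Import complex measurable_realfun ring lra.
Set Implicit Arguments.
Unset Strict Implicit.
Unset Printing Implicit Defensive.
Import Order.TTheory GRing.Theory Num.Theory.
Import numFieldNormedType.Exports.
Local Open Scope classical_set_scope.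
Local Open Scope ring_scope.
Local Open Scope complex_scope.

(** For elementary tensors the formula for the dual convolution is a Bochner
    integral of rank one operators.  A matrix coefficient A |-> <A a, b> is a
    bounded functional for the trace norm, so it passes under that integral
    (coefficient_box_tensor), and Fubini turns the coefficient into an integral
    over triples (h, (s, t)) of conj (b s) * k * a t, where
    k = K1 (s/(1+h), t/(1+h)) * K2 (hs/(1+h), ht/(1+h)) and K1, K2 are the
    kernels of the two tensors.

    Everything that has to converge is controlled by one estimate
    (paired_twist_estimate): for tensors the integral of |conj (b s) * k * a t|
    over all triples is at most the product of the six norms.  One
    Cauchy-Schwarz inequality on the space of triples separates the factors in s
    from those in t; after the dilation s = (1+h) x each half becomes a product
    of integrals, because dt/|t| is invariant under scaling.

    A trace class operator is a nuclear series of tensors, and the partial sums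
    of the corresponding kernels converge almost everywhere to its kernel
    (kernel_series).  The estimate, summed over pairs of terms, gives a dominating
    function, so dominated convergence extends the formula for the coefficients
    from tensors to arbitrary operators (paired_twist_kernels); on the side of
    the operators the double series converges because dual convolution is bilinear
    and contractive (coefficient_box_series).  By Fubini, the function of (s, t)
    obtained by integrating k in dh/|h| has the same coefficients as the kernel
    of the dual convolution, and coefficients determine a kernel almost
    everywhere (kernel_unique).  This gives absolute convergence and the first
    formula (box_kernel).

    The second formula is the substitution h = u/(1-u), split into a translation,
    an inversion and a reflection (lebesgue_moebius). *)

(** * Integration of complex-valued functions *)

Section ComplexNumbers.
Variable R : rcfType.
Implicit Types z w : R[i].

Lemma normc_ge0 z : 0 <= normc z.
Proof. by case: z => a b; exact: sqrtr_ge0. Qed.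

Lemma normr_Re_le z : `|complex.Re z| <= normc z.
Proof.
by case: z => a b /=; rewrite -sqrtr_sqr ler_wsqrtr// lerDl sqr_ge0.
Qed.

Lemma normr_Im_le z : `|complex.Im z| <= normc z.
Proof.
by case: z => a b /=; rewrite -sqrtr_sqr ler_wsqrtr// lerDr sqr_ge0.
Qed.

Lemma normc_triangle z w : normc (z + w) <= normc z + normc w.
Proof. exact: (@le_normcD R z w). Qed.

Lemma normc_opp z : normc (- z) = normc z.
Proof. exact: (@normcN R z). Qed.

Lemma normc_conj z : normc z^* = normc z.
Proof. by case: z => a b /=; rewrite sqrrN. Qed.

Lemma normc_real (a : R) : normc a%:C = `|a|.
Proof. by rewrite /= expr0n/= addr0 sqrtr_sqr. Qed.

Lemma normc_le_ReIm z : normc z <= `|complex.Re z| + `|complex.Im z|.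
Proof.
rewrite [z in leLHS]complexE; apply: le_trans (normc_triangle _ _) _.
by rewrite Normc.normcM !normc_real /= expr0n /= add0r expr1n sqrtr1 mul1r.
Qed.

Lemma cReM z w : complex.Re (z * w) =
  complex.Re z * complex.Re w - complex.Im z * complex.Im w.
Proof. by case: z => a b; case: w. Qed.

Lemma cImM z w : complex.Im (z * w) =
  complex.Re z * complex.Im w + complex.Im z * complex.Re w.
Proof. by case: z => a b; case: w. Qed.

Lemma cReD z w : complex.Re (z + w) = complex.Re z + complex.Re w.
Proof. by case: z => a b; case: w. Qed.

Lemma cImD z w : complex.Im (z + w) = complex.Im z + complex.Im w.
Proof. by case: z => a b; case: w. Qed.

Lemma complex_ext z w :
  complex.Re z = complex.Re w -> complex.Im z = complex.Im w -> z = w.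
Proof. by case: z => a b; case: w => c e /= -> ->. Qed.

Lemma Re_sum I (r : seq I) (P : pred I) (F : I -> R[i]) :
  complex.Re (\sum_(i <- r | P i) F i) = \sum_(i <- r | P i) complex.Re (F i).
Proof. by apply: (big_morph _ cReD). Qed.

Lemma Im_sum I (r : seq I) (P : pred I) (F : I -> R[i]) :
  complex.Im (\sum_(i <- r | P i) F i) = \sum_(i <- r | P i) complex.Im (F i).
Proof. by apply: (big_morph _ cImD). Qed.

Lemma normc_sum I (r : seq I) (P : pred I) (F : I -> R[i]) :
  normc (\sum_(i <- r | P i) F i) <= \sum_(i <- r | P i) normc (F i).
Proof.
elim/big_ind2 : _ => //; first by rewrite Normc.normc0.
move=> z a w b za wb; apply: le_trans (normc_triangle _ _) _; exact: lerD.
Qed.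

End ComplexNumbers.

Lemma cvg0_le (R : realFieldType) (u v : nat -> R) :
  (forall n, 0 <= u n <= v n) -> v n @[n --> \oo] --> (0 : R) ->
  u n @[n --> \oo] --> (0 : R).
Proof.
move=> uv v0; apply: (@squeeze_cvgr _ _ _ _ (cst 0) v); [exact: nearW|exact: cvg_cst|exact: v0].
Qed.

Section ComplexLimits.
Variable R : realType.
Implicit Types (u v : nat -> R[i]) (z w : R[i]).

(** Componentwise convergence, which is the usual convergence of complex
    sequences expressed through the real limits that integrals provide. *)
Definition ccvg u z :=
  complex.Re (u n) @[n --> \oo] --> complex.Re z /\
  complex.Im (u n) @[n --> \oo] --> complex.Im z.

Lemma ccvgM u v z w : ccvg u z -> ccvg v w -> ccvg (fun n => u n * v n) (z * w).
Proof.
move=> [u1 u2] [v1 v2]; split.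
  under eq_fun do rewrite cReM; rewrite cReM.
  by apply: cvgB; apply: cvgM.
under eq_fun do rewrite cImM; rewrite cImM.
by apply: cvgD; apply: cvgM.
Qed.

Lemma ccvg_cst z : ccvg (fun=> z) z.
Proof. by split; exact: cvg_cst. Qed.

Lemma ccvg_unique u z w : ccvg u z -> ccvg u w -> z = w.
Proof.
move=> [u1 u2] [v1 v2]; apply: complex_ext.
  exact: (cvg_unique _ u1 v1).
exact: (cvg_unique _ u2 v2).
Qed.

Lemma ccvg_normP u z :
  (normc (u n - z) @[n --> \oo] --> (0 : R)) <-> ccvg u z.
Proof.
have aux (f : nat -> R) (l : R) : (f n @[n --> \oo] --> l) <->
    (`|f n - l| @[n --> \oo] --> (0 : R)).
  split.
    by move=> fl; apply/norm_cvg0P; apply/subr_cvg0.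
  by move/norm_cvg0P/subr_cvg0.
split.
  move=> uz; split; apply/aux.
    apply: cvg0_le uz => n.
    rewrite normr_ge0/=; apply: le_trans (normr_Re_le _).
    by case: (u n) => ? ?; case: (z).
  apply: cvg0_le uz => n.
  rewrite normr_ge0/=; apply: le_trans (normr_Im_le _).
  by case: (u n) => ? ?; case: (z).
move=> [/aux u1 /aux u2].
apply: (@cvg0_le _ _ (fun n => `|complex.Re (u n) - complex.Re z| +
    `|complex.Im (u n) - complex.Im z|)) => [n|]; last first.
  by rewrite -[X in _ --> X](addr0 (0 : R)); exact: cvgD u1 u2.
rewrite normc_ge0/=; apply: le_trans (normc_le_ReIm _) _.
by case: (u n) => ? ?; case: (z).
Qed.

Lemma ccvg_bounded u z (e : nat -> R) :
  (forall n, normc (u n - z) <= e n) -> e n @[n --> \oo] --> (0 : R) -> ccvg u z.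
Proof.
move=> ue e0; apply/ccvg_normP.
apply: cvg0_le e0 => n.
by rewrite normc_ge0 ue.
Qed.

End ComplexLimits.

Section ComplexMeasurable.
Context d (T : measurableType d) (R : realType).
Implicit Types f g : T -> R[i].

Lemma measurable_normc f : cmeasurable f -> measurable_fun setT (fun x => normc (f x)).
Proof.
move=> mf; have := measurable_normc2 mf => mf2.
rewrite (_ : (fun x => _) = (fun x => (normc (f x) ^+ 2) `^ 2^-1)).
  exact: (measurableT_comp (measurable_powR _)).
apply/funext => x; rewrite powR12_sqrt ?sqr_ge0// sqrtr_sqr ger0_norm//.
exact: normc_ge0.
Qed.

Lemma cmeasurable_cst (c : R[i]) : cmeasurable (fun _ : T => c).
Proof. by split; exact: measurable_cst. Qed.

Lemma cmeasurable_real (h : T -> R) : measurable_fun setT h ->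
  cmeasurable (fun x => (h x)%:C).
Proof. by move=> mh; split => //=; exact: measurable_cst. Qed.

Lemma cmeasurableM f g : cmeasurable f -> cmeasurable g ->
  cmeasurable (fun x => f x * g x).
Proof.
move=> [f1 f2] [g1 g2]; split.
  under eq_fun do rewrite cReM.
  by apply: measurable_funB; apply: measurable_funM.
under eq_fun do rewrite cImM.
by apply: measurable_funD; apply: measurable_funM.
Qed.

Lemma cmeasurable_conj f : cmeasurable f -> cmeasurable (fun x => (f x)^*).
Proof.
move=> [f1 f2]; split.
  by rewrite (_ : (fun x => _) = fun x => complex.Re (f x))//;
    apply/funext => x; case: (f x).
rewrite (_ : (fun x => _) = fun x => - complex.Im (f x)).
  exact: measurableT_comp.
by apply/funext => x; case: (f x).
Qed.

Lemma cmeasurable_sum I (r : seq I) (F : I -> T -> R[i]) :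
  (forall i, cmeasurable (F i)) -> cmeasurable (fun x => \sum_(i <- r) F i x).
Proof.
move=> mF; elim: r => [|i r ih].
  by under eq_fun do rewrite big_nil; exact: cmeasurable_cst.
by under eq_fun do rewrite big_cons; exact: cmeasurableD.
Qed.

End ComplexMeasurable.

Lemma cmeasurable_comp d d' (T : measurableType d) (U : measurableType d')
    (R : realType) (phi : T -> U) (f : U -> R[i]) :
  measurable_fun setT phi -> cmeasurable f -> cmeasurable (fun x => f (phi x)).
Proof.
by move=> mphi [f1 f2]; split; [exact: (measurableT_comp f1)|exact: (measurableT_comp f2)].
Qed.

Section ComplexIntegration.
Context d (T : measurableType d) (R : realType) (mu : {measure set T -> \bar R}).
Implicit Types f g : T -> R[i].

Lemma cintegrableP f : cintegrable mu f <->
  mu.-integrable setT (fun x => (complex.Re (f x))%:E) /\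
  mu.-integrable setT (fun x => (complex.Im (f x))%:E).
Proof.
split.
  move=> [[f1 f2] fo].
  have mn : measurable_fun setT (fun x => (normc (f x))%:E).
    by apply/measurable_EFinP/measurable_normc.
  have ni : mu.-integrable setT (fun x => (normc (f x))%:E).
    apply/integrableP; split => //.
    by under eq_integral do rewrite /= ger0_norm ?normc_ge0//.
  split; (apply: le_integrable ni => //; first exact/measurable_EFinP) => x _;
    rewrite /= lee_fin [leRHS]ger0_norm ?normc_ge0//.
    exact: normr_Re_le.
  exact: normr_Im_le.
move=> [f1 f2]; have mf : cmeasurable f.
  by split; apply/measurable_EFinP; [exact: (measurable_int _ f1)|exact: (measurable_int _ f2)].
split => //.
have /integrableP[_] := integrableD measurableT (integrable_abse f1) (integrable_abse f2).
apply: le_lt_trans; apply: ge0_le_integral => //=.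
- by move=> x _; rewrite lee_fin normc_ge0.
- exact/measurable_EFinP/measurable_normc.
- case: mf => ? ?; apply/measurable_EFinP; apply: measurableT_comp => //.
  by apply: measurable_funD; apply: measurableT_comp.
- move=> x _; rewrite lee_fin (le_trans (normc_le_ReIm _))// ler_norm//.
Qed.

Lemma cmeasurable_integrable f : cintegrable mu f -> cmeasurable f.
Proof. by case. Qed.

Lemma cintegrable_le f (g : T -> R) : cmeasurable f ->
  measurable_fun setT g -> (forall x, normc (f x) <= g x) ->
  (\int[mu]_x (g x)%:E < +oo)%E -> cintegrable mu f.
Proof.
move=> mf mg fg goo; split => //; apply: le_lt_trans goo.
apply: ge0_le_integral => //.
- by move=> x _; rewrite lee_fin normc_ge0.
- exact/measurable_EFinP/measurable_normc.
- exact/measurable_EFinP.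
- by move=> x _; rewrite lee_fin.
Qed.

Lemma cintegrableD f g : cintegrable mu f -> cintegrable mu g ->
  cintegrable mu (fun x => f x + g x).
Proof.
move=> /cintegrableP[f1 f2] /cintegrableP[g1 g2]; apply/cintegrableP; split.
  under eq_fun do rewrite cReD EFinD; exact: integrableD.
under eq_fun do rewrite cImD EFinD; exact: integrableD.
Qed.

Lemma cintegralD f g : cintegrable mu f -> cintegrable mu g ->
  cintegral mu (fun x => f x + g x) = cintegral mu f + cintegral mu g.
Proof.
move=> /cintegrableP[f1 f2] /cintegrableP[g1 g2]; apply: complex_ext => /=.
  by under eq_Rintegral do rewrite cReD; rewrite RintegralD// cReD.
by under eq_Rintegral do rewrite cImD; rewrite RintegralD// cImD.
Qed.

Lemma cintegrableZ (c : R[i]) f : cintegrable mu f ->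
  cintegrable mu (fun x => c * f x).
Proof.
move=> [mf fo]; split; first exact: cmeasurableZ.
under eq_integral do rewrite Normc.normcM EFinM.
rewrite ge0_integralZl//; last 3 first.
- exact/measurable_EFinP/measurable_normc.
- by move=> x _; rewrite lee_fin normc_ge0.
- by rewrite lee_fin normc_ge0.
by apply: lte_mul_pinfty => //; rewrite lee_fin normc_ge0.
Qed.

Lemma cintegralZ (c : R[i]) f : cintegrable mu f ->
  cintegral mu (fun x => c * f x) = c * cintegral mu f.
Proof.
move=> /cintegrableP[f1 f2].
have iZ (k : R) (h : T -> R) : mu.-integrable setT (fun x => (h x)%:E) ->
    mu.-integrable setT (fun x => (k * h x)%:E).
  by move=> /(integrableZl measurableT k).
apply: complex_ext => /=; rewrite ?cReM ?cImM/=.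
  under eq_Rintegral do rewrite cReM.
  rewrite RintegralB//; [|exact: iZ..].
  by rewrite !RintegralZl.
under eq_Rintegral do rewrite cImM.
rewrite RintegralD//; [|exact: iZ..].
by rewrite !RintegralZl.
Qed.

Lemma cintegrableB f g : cintegrable mu f -> cintegrable mu g ->
  cintegrable mu (fun x => f x - g x).
Proof.
move=> fi gi; apply: cintegrableD => //.
by under eq_fun do rewrite -mulN1r; exact: cintegrableZ.
Qed.

Lemma cintegralB f g : cintegrable mu f -> cintegrable mu g ->
  cintegral mu (fun x => f x - g x) = cintegral mu f - cintegral mu g.
Proof.
move=> fi gi; rewrite cintegralD//; last first.
  by under eq_fun do rewrite -mulN1r; exact: cintegrableZ.
by under [in cintegral mu (fun x => - g x)]eq_fun do rewrite -mulN1r;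
  rewrite cintegralZ// mulN1r.
Qed.

Lemma cintegral0 : cintegral mu (fun=> 0) = 0.
Proof. by apply: complex_ext => /=; rewrite Rintegral_cst// mul0r. Qed.

Lemma cintegrable0 : cintegrable mu (fun=> 0).
Proof.
split; first exact: cmeasurable_cst.
by under eq_integral do rewrite Normc.normc0; rewrite integral0 ltry.
Qed.

Lemma cintegrable_sum I (r : seq I) (F : I -> T -> R[i]) :
  (forall i, cintegrable mu (F i)) -> cintegrable mu (fun x => \sum_(i <- r) F i x).
Proof.
move=> iF; elim: r => [|i r ih].
  by under eq_fun do rewrite big_nil; exact: cintegrable0.
by under eq_fun do rewrite big_cons; exact: cintegrableD.
Qed.

Lemma cintegral_sum I (r : seq I) (F : I -> T -> R[i]) :
  (forall i, cintegrable mu (F i)) ->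
  cintegral mu (fun x => \sum_(i <- r) F i x) = \sum_(i <- r) cintegral mu (F i).
Proof.
move=> iF; elim: r => [|i r ih].
  by under eq_fun do rewrite big_nil; rewrite big_nil cintegral0.
under eq_fun do rewrite big_cons.
by rewrite big_cons cintegralD ?ih//; exact: cintegrable_sum.
Qed.

(** The constant 2 comes from bounding the real and the imaginary part
    separately; the applications only ask for some constant. *)
Lemma cintegral_norm_le f : cintegrable mu f ->
  ((normc (cintegral mu f))%:E <= 2%:E * \int[mu]_x (normc (f x))%:E)%E.
Proof.
move=> fi; have [mf fo] := fi; have /cintegrableP[f1 f2] := fi.
have half (h : T -> R) : mu.-integrable setT (fun x => (h x)%:E) ->
    (forall x, `|h x| <= normc (f x)) ->
    (`|\int[mu]_x h x|%:E <= \int[mu]_x (normc (f x))%:E)%E.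
  move=> hi hf; have mh := measurable_int _ hi.
  rewrite (@EFin_normr_Rintegral _ _ _ mu setT h)//.
  apply: (le_trans (le_abse_integral _ _ _)) => //.
  apply: ge0_le_integral => //.
  - exact: measurableT_comp.
  - exact/measurable_EFinP/measurable_normc.
  - by move=> x _; rewrite lee_fin.
rewrite (_ : 2%:E = 1 + 1)%E// ge0_muleDl// mul1e.
apply: (@le_trans _ _ (`|\int[mu]_x complex.Re (f x)|%:E + `|\int[mu]_x complex.Im (f x)|%:E)%E).
  by rewrite -EFinD lee_fin; exact: normc_le_ReIm.
by apply: leeD; apply: half => // x; rewrite ?normr_Re_le ?normr_Im_le.
Qed.

Lemma ae_cintegrable f g : cmeasurable g -> {ae mu, forall x, f x = g x} ->
  cintegrable mu f -> cintegrable mu g.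
Proof.
move=> mg fg [mf fo]; split => //; rewrite (@ge0_ae_eq_integral _ _ _ mu setT
  (fun x => (normc (g x))%:E) (fun x => (normc (f x))%:E))//.
- exact/measurable_EFinP/measurable_normc.
- exact/measurable_EFinP/measurable_normc.
- by move=> x _; rewrite lee_fin normc_ge0.
- by move=> x _; rewrite lee_fin normc_ge0.
- by apply: filterS fg => x -> _.
Qed.

Lemma ae_eq_cintegral f g : cmeasurable f -> cmeasurable g ->
  {ae mu, forall x, f x = g x} -> cintegral mu f = cintegral mu g.
Proof.
move=> [f1 f2] [g1 g2] fg; apply: complex_ext => /=; congr fine;
  apply: ae_eq_integral => //; try exact/measurable_EFinP;
  by apply: filterS fg => x -> _.
Qed.

(** The monotone limit of the g n is integrable by monotone convergence and
    lies above all of them. *)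
Lemma monotone_dominating (g : nat -> T -> R) (M : R) :
  (forall n, measurable_fun setT (g n)) ->
  (forall x, nondecreasing_seq (g ^~ x)) -> (forall n x, 0 <= g n x) ->
  (forall n, (\int[mu]_x (g n x)%:E <= M%:E)%E) ->
  exists2 G : T -> \bar R, mu.-integrable setT G & forall n x, ((g n x)%:E <= G x)%E.
Proof.
move=> mg ndg g0 gM; pose G x := limn (fun n => (g n x)%:E).
have ndG x : nondecreasing_seq (fun n => (g n x)%:E).
  by move=> m n mn; rewrite lee_fin; exact: ndg.
have gG n x : ((g n x)%:E <= G x)%E.
  rewrite /G (cvg_lim _ (ereal_nondecreasing_cvgn (ndG x)))//.
  by apply: ereal_sup_ubound; exists n.
exists G => //; apply/integrableP; split.
  apply: (@emeasurable_fun_cvg _ _ _ _ (fun n x => (g n x)%:E)) => //.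
    by move=> n; exact/measurable_EFinP.
  move=> x _; exact: (ereal_nondecreasing_is_cvgn (ndG x)).
under eq_integral => x _.
  rewrite gee0_abs; last by apply: le_trans (gG 0%N x); rewrite lee_fin.
  over.
apply: le_lt_trans (ltry M).
rewrite /G (@monotone_convergence _ _ _ mu setT measurableT
  (fun n x => (g n x)%:E)); last 3 first.
- by move=> n; exact/measurable_EFinP.
- by move=> n x _; rewrite lee_fin.
- by move=> x _; exact: ndG.
apply: lime_le; last exact: nearW.
apply: ereal_nondecreasing_is_cvgn => m n mn; apply: ge0_le_integral => //.
- by move=> x _; rewrite lee_fin.
- exact/measurable_EFinP.
- exact/measurable_EFinP.
- by move=> x _; exact: ndG.
Qed.

(** Dominated convergence in the form that nuclear series supply: the bound is
    an increasing sequence of functions with bounded integrals, such as the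
    partial sums of the absolute values. *)
Lemma cvg_cintegral (f_ : nat -> T -> R[i]) f (g : nat -> T -> R) (M : R) :
  (forall n, cmeasurable (f_ n)) -> cmeasurable f ->
  (forall n, measurable_fun setT (g n)) ->
  (forall x, nondecreasing_seq (g ^~ x)) ->
  (forall n x, normc (f_ n x) <= g n x) ->
  (forall n, (\int[mu]_x (g n x)%:E <= M%:E)%E) ->
  {ae mu, forall x, ccvg (f_ ^~ x) (f x)} ->
  cintegrable mu f /\ ccvg (fun n => cintegral mu (f_ n)) (cintegral mu f).
Proof.
move=> mf_ mf mg ndg fg gM f_f.
have g0 n x : 0 <= g n x by apply: le_trans (fg n x); exact: normc_ge0.
have [G iG gG] := monotone_dominating mg ndg g0 gM.
have half (k : R[i] -> R) : (forall z, `|k z| <= normc z) ->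
    (forall n, measurable_fun setT (fun x => k (f_ n x))) ->
    measurable_fun setT (fun x => k (f x)) ->
    {ae mu, forall x, (k (f_ n x)) @[n --> \oo] --> (k (f x))} ->
    mu.-integrable setT (fun x => (k (f x))%:E) /\
    \int[mu]_x k (f_ n x) @[n --> \oo] --> \int[mu]_x k (f x).
  move=> kn mkf_ mkf kf.
  have [|||||i1 _ i2] := @dominated_convergence _ _ _ mu setT measurableT
    (fun n x => (k (f_ n x))%:E) (fun x => (k (f x))%:E) G.
  - by move=> n; exact/measurable_EFinP.
  - exact/measurable_EFinP.
  - apply: filterS kf => x kfx _.
    by apply: cvg_EFin; [exact: nearW|exact: kfx].
  - exact: iG.
  - apply: nearW => x n _; apply: le_trans (gG n x).
    by rewrite /= lee_fin; apply: le_trans (kn _) (fg _ _).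
  split => //; apply: fine_cvg; rewrite fineK; first exact: i2.
  by have := integrable_fin_num measurableT i1.
have [r1 r2] := half (@complex.Re R) (@normr_Re_le R) (fun n => (mf_ n).1) mf.1
   (filterS (fun x (h : ccvg (f_ ^~ x) (f x)) => h.1) f_f).
have [s1 s2] := half (@complex.Im R) (@normr_Im_le R) (fun n => (mf_ n).2) mf.2
   (filterS (fun x (h : ccvg (f_ ^~ x) (f x)) => h.2) f_f).
by split; [exact/cintegrableP|split].
Qed.

End ComplexIntegration.

(** * Measure preserving maps and product measures *)

Section MeasurePreserving.
Context d1 d2 (X : measurableType d1) (Y : measurableType d2) (R : realType).
Implicit Types (mu : {measure set X -> \bar R}) (nu : {measure set Y -> \bar R}).

Definition measure_preserving mu nu (phi : X -> Y) :=
  measurable_fun setT phi /\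
  forall A, measurable A -> mu (phi @^-1` A) = nu A.

Definition image_measure mu (phi : X -> Y) (mphi : measurable_fun setT phi) :
    {measure set Y -> \bar R} :=
  measure_function_pushforward__canonical__measure_function_Measure mu mphi.

Lemma image_measureE mu phi (mphi : measurable_fun setT phi) A :
  image_measure mu mphi A = mu (phi @^-1` A).
Proof. by []. Qed.

Lemma preserving_integral mu nu phi (f : Y -> \bar R) :
  measure_preserving mu nu phi -> measurable_fun setT f ->
  (forall y, 0 <= f y)%E ->
  (\int[nu]_y f y = \int[mu]_x f (phi x))%E.
Proof.
move=> [mphi pphi] mf f0.
have /= := @ge0_integral_pushforward _ _ _ _ _ _ mphi mu setT f measurableT mf.
rewrite preimage_setT => <-; last by move=> y _; exact: f0.
by apply: eq_measure_integral => A mA _; rewrite /= /pushforward pphi.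
Qed.

Lemma preserving_cintegrable mu nu phi (f : Y -> R[i]) :
  measure_preserving mu nu phi -> cintegrable nu f ->
  cintegrable mu (fun x => f (phi x)).
Proof.
move=> pphi [mf fo]; split; first exact: cmeasurable_comp pphi.1 mf.
rewrite -(preserving_integral (f := fun y => (normc (f y))%:E) pphi) ?fo//.
  exact/measurable_EFinP/measurable_normc.
by move=> y; rewrite lee_fin normc_ge0.
Qed.

Lemma preserving_cintegral mu nu phi (f : Y -> R[i]) :
  measure_preserving mu nu phi -> cintegrable nu f ->
  cintegral nu f = cintegral mu (fun x => f (phi x)).
Proof.
move=> pphi /[dup] fi /cintegrableP[f1 f2].
have /cintegrableP[g1 g2] := preserving_cintegrable pphi fi.
have aux (h : Y -> R) : nu.-integrable setT (fun x => (h x)%:E) ->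
    mu.-integrable setT (fun x => (h (phi x))%:E) ->
    (\int[nu]_y (h y)%:E = \int[mu]_x (h (phi x))%:E)%E.
  move=> hi hi'; have [mphi pphi'] := pphi.
  have /= := @integral_pushforward _ _ _ _ _ _ mphi mu setT (EFin \o h)
    (measurable_int _ hi) hi' measurableT.
  rewrite preimage_setT => <-.
  by apply: eq_measure_integral => A mA _; rewrite /= /pushforward pphi'.
by apply: complex_ext => /=; congr fine; exact: aux.
Qed.

End MeasurePreserving.

Lemma measure_preserving_comp d1 d2 d3 (X : measurableType d1)
    (Y : measurableType d2) (Z : measurableType d3) (R : realType)
    (mu : {measure set X -> \bar R}) (nu : {measure set Y -> \bar R})
    (xi : {measure set Z -> \bar R}) (phi : X -> Y) (psi : Y -> Z) :
  measure_preserving mu nu phi -> measure_preserving nu xi psi ->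
  measure_preserving mu xi (psi \o phi).
Proof.
move=> [mphi pphi] [mpsi ppsi]; split; first exact: measurableT_comp.
move=> A mA; rewrite comp_preimage pphi ?ppsi//.
by rewrite -[X in measurable X]setTI; exact: mpsi.
Qed.

Section Products.
Context d1 d2 (T1 : measurableType d1) (T2 : measurableType d2) (R : realType).
Variable m1 : {sigma_finite_measure set T1 -> \bar R}.
Variable m2 : {sigma_finite_measure set T2 -> \bar R}.

(** Both measures agree on rectangles, which determine a measure on a product. *)
Lemma swap_preserving : measure_preserving (m2 \x m1)%E (m1 \x m2)%E
  (fun p => (p.2, p.1)).
Proof.
have ms : measurable_fun setT (fun p : T2 * T1 => (p.2, p.1)).
  by apply: measurable_fun_pair.
split => // A mA; rewrite -[LHS](image_measureE _ ms); apply/esym.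
apply: product_measure_unique => // B C mB mC; rewrite image_measureE.
rewrite (_ : _ @^-1` _ = C `*` B); last first.
  by apply/seteqP; split => -[x y] /= [].
by rewrite muleC; exact: product_measure1E.
Qed.

Lemma prod_preserving d3 d4 (T3 : measurableType d3) (T4 : measurableType d4)
    (m3 : {sigma_finite_measure set T3 -> \bar R})
    (m4 : {sigma_finite_measure set T4 -> \bar R}) phi psi :
  measure_preserving m1 m3 phi -> measure_preserving m2 m4 psi ->
  measure_preserving (m1 \x m2)%E (m3 \x m4)%E (fun p => (phi p.1, psi p.2)).
Proof.
move=> [mphi pphi] [mpsi ppsi].
have ms : measurable_fun setT (fun p : T1 * T2 => (phi p.1, psi p.2)).
  by apply: measurable_fun_pair; apply: measurableT_comp.
split => // A mA; rewrite -[LHS](image_measureE _ ms); apply/esym.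
apply: product_measure_unique => // B C mB mC; rewrite image_measureE.
rewrite -pphi// -ppsi//; apply: (product_measure1E m1 m2).
- by rewrite -[X in measurable X]setTI; exact: mphi.
- by rewrite -[X in measurable X]setTI; exact: mpsi.
Qed.

(** By Tonelli, since for almost every x the section of a pulled back null set
    is itself the preimage of that null set under a measure preserving map. *)
Lemma skew_ae d3 (T3 : measurableType d3) (m3 : {measure set T3 -> \bar R})
    (phi : T1 * T2 -> T3) (P : T3 -> Prop) : measurable_fun setT phi ->
  {ae m1, forall x, measure_preserving m2 m3 (fun y => phi (x, y))} ->
  {ae m3, forall y, P y} -> {ae (m1 \x m2)%E, forall p, P (phi p)}.
Proof.
move=> mphi pphi [A [mA A0 PA]]; exists (phi @^-1` A); split.
- by rewrite -[X in measurable X]setTI; exact: mphi.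
- rewrite /product_measure1 (@ae_eq_integral _ _ _ m1 setT (cst 0%E))//.
  + by rewrite integral0.
  + apply: measurable_fun_xsection.
    by rewrite -[X in measurable X]setTI; exact: mphi.
  + apply: filterS pphi => x [mx px] _ /=.
    rewrite -A0 -px//; congr (m2 _); apply/seteqP.
    by split => y; rewrite /xsection/= ?inE.
- by move=> x /= nP; exact: PA.
Qed.

Lemma ae_fst (P : T1 -> Prop) : {ae m1, forall x, P x} ->
  {ae (m1 \x m2)%E, forall p, P p.1}.
Proof.
move=> [A [mA A0 PA]]; exists (A `*` setT); split.
- exact: measurableX.
- apply: etrans (product_measure1E m1 m2 mA measurableT) _.
  by rewrite [X in (X * _)%E]A0 mul0e.
- by move=> [x y] /= nP; split => //; exact: PA.
Qed.

Lemma ae_snd (P : T2 -> Prop) : {ae m2, forall x, P x} ->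
  {ae (m1 \x m2)%E, forall p, P p.2}.
Proof.
move=> [A [mA A0 PA]]; exists (setT `*` A); split.
- exact: measurableX.
- apply: etrans (product_measure1E m1 m2 measurableT mA) _.
  by rewrite [X in (_ * X)%E]A0 mule0.
- by move=> [x y] /= nP; split => //; exact: PA.
Qed.

Lemma cmeasurable_section (f : T1 * T2 -> R[i]) x : cmeasurable f ->
  cmeasurable (fun y => f (x, y)).
Proof. by apply: cmeasurable_comp; exact: pair1_measurable. Qed.

Lemma cintegral_fubini (f : T1 * T2 -> R[i]) : cintegrable (m1 \x m2)%E f ->
  [/\ {ae m1, forall x, cintegrable m2 (fun y => f (x, y))},
      cmeasurable (fun x => cintegral m2 (fun y => f (x, y))),
      cintegrable m1 (fun x => cintegral m2 (fun y => f (x, y))) &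
      cintegral (m1 \x m2)%E f =
      cintegral m1 (fun x => cintegral m2 (fun y => f (x, y)))].
Proof.
move=> /[dup] -[mf _] /cintegrableP[f1 f2].
have aux (h : T1 * T2 -> R) : (m1 \x m2)%E.-integrable setT (fun p => (h p)%:E) ->
    [/\ measurable_fun setT (fun x => \int[m2]_y h (x, y)),
        m1.-integrable setT (fun x => (\int[m2]_y h (x, y))%:E) &
       \int[(m1 \x m2)%E]_p h p = \int[m1]_x \int[m2]_y h (x, y)].
  move=> hi; have mF := measurable_fubini_F hi.
  have m' : measurable_fun setT (fun x => \int[m2]_y h (x, y)).
    exact: (measurableT_comp (@fine_measurable _ setT measurableT) mF).
  have ae' : ae_eq m1 setT (fubini_F m2 (fun p => (h p)%:E))
      (fun x => (\int[m2]_y h (x, y))%:E).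
    apply: filterS (ae_integrable1 hi) => x hx _.
    by rewrite /Rintegral fineK//; exact: (integrable_fin_num measurableT hx).
  split => //.
    have /integrableP[_ Fo] := integrable_fubini_F hi.
    apply/integrableP; split; first exact/measurable_EFinP.
    apply: le_lt_trans Fo; rewrite le_eqVlt; apply/orP; left; apply/eqP.
    apply: ge0_ae_eq_integral => //.
    - by apply: measurableT_comp => //; exact/measurable_EFinP.
    - by apply: measurableT_comp.
    - by apply: filterS ae' => x /(_ I) hx _; rewrite -hx.
  rewrite /Rintegral -integral12_prod_meas1//; congr fine.
  apply: ae_eq_integral => //; exact/measurable_EFinP.
have [a1 a2 a3] := aux _ f1; have [b1 b2 b3] := aux _ f2.
split => //.
- apply: filterS2 (ae_integrable1 f1) (ae_integrable1 f2) => x g1 g2.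
  by apply/cintegrableP.
- exact/cintegrableP.
- by apply: complex_ext.
Qed.

End Products.

Section ProductsSwap.
Context d1 d2 (T1 : measurableType d1) (T2 : measurableType d2) (R : realType).
Variable m1 : {sigma_finite_measure set T1 -> \bar R}.
Variable m2 : {sigma_finite_measure set T2 -> \bar R}.

Lemma cintegral_fubini_swap (f : T1 * T2 -> R[i]) : cintegrable (m1 \x m2)%E f ->
  [/\ {ae m2, forall y, cintegrable m1 (fun x => f (x, y))},
      cmeasurable (fun y => cintegral m1 (fun x => f (x, y))),
      cintegrable m2 (fun y => cintegral m1 (fun x => f (x, y))) &
      cintegral (m1 \x m2)%E f =
      cintegral m2 (fun y => cintegral m1 (fun x => f (x, y)))].
Proof.
move=> fi; have sp := swap_preserving m1 m2.
have [a1 a2 a3 a4] := cintegral_fubini (preserving_cintegrable sp fi).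
by split => //; rewrite (preserving_cintegral sp fi) a4.
Qed.

Lemma ge0_integral_tensor (u : T1 -> \bar R) (v : T2 -> \bar R) :
  measurable_fun setT u -> measurable_fun setT v ->
  (forall x, 0 <= u x)%E -> (forall y, 0 <= v y)%E ->
  (\int[(m1 \x m2)%E]_p (u p.1 * v p.2) =
   \int[m1]_x u x * \int[m2]_y v y)%E.
Proof.
move=> mu mv u0 v0; rewrite (fubini_tonelli1 (fun p => u p.1 * v p.2)%E).
- under eq_integral do rewrite /fubini_F/= ge0_integralZl//.
  by rewrite ge0_integralZr//; exact: integral_ge0.
- apply: emeasurable_funM.
    by apply: (measurableT_comp mu).
  by apply: (measurableT_comp mv).
- by move=> p; rewrite mule_ge0.
Qed.

(** The value is measurable also where the section fails to be integrable: it
    comes from the difference of the integrals of the positive and the negative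
    parts, which Tonelli shows to be measurable. *)
Lemma cmeasurable_cintegral_param (f : T1 * T2 -> R[i]) : cmeasurable f ->
  cmeasurable (fun y => cintegral m1 (fun x => f (x, y))).
Proof.
have aux (h : T1 * T2 -> R) : measurable_fun setT h ->
    measurable_fun setT (fun y => \int[m1]_x h (x, y)).
  move=> mh; apply: (measurableT_comp (@fine_measurable _ setT measurableT)).
  under eq_fun do rewrite integralE.
  have mh' : measurable_fun setT (fun p => (h p)%:E) by exact/measurable_EFinP.
  apply: emeasurable_funB.
    under eq_fun do under eq_integral do rewrite funeposE.
    apply: (measurable_fun_fubini_tonelli_G (m1 := m1) (fun p => maxe (h p)%:E 0%E)).
      rewrite (_ : (fun p => _) = (fun p => (h p)%:E)^\+%E); first exact: measurable_funepos.
      by apply/funext => p; rewrite funeposE.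
    by move=> p; rewrite le_max lexx orbT.
  under eq_fun do under eq_integral do rewrite funenegE.
  apply: (measurable_fun_fubini_tonelli_G (m1 := m1) (fun p => maxe (- (h p)%:E) 0%E)%E).
    rewrite (_ : (fun p => _) = (fun p => (h p)%:E)^\-%E); first exact: measurable_funeneg.
    by apply/funext => p; rewrite funenegE.
  by move=> p; rewrite le_max lexx orbT.
by move=> [f1 f2]; split; [exact: (aux _ f1)|exact: (aux _ f2)].
Qed.

Lemma cintegrable_tensor (u : T1 -> R[i]) (v : T2 -> R[i]) :
  cintegrable m1 u -> cintegrable m2 v ->
  cintegrable (m1 \x m2)%E (fun p => u p.1 * v p.2).
Proof.
move=> [mu uo] [mv vo]; split.
  apply: cmeasurableM.
    by apply: (cmeasurable_comp (phi := fst) (f := u)).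
  by apply: (cmeasurable_comp (phi := snd) (f := v)).
under eq_integral do rewrite Normc.normcM EFinM.
rewrite (@ge0_integral_tensor (fun x => (normc (u x))%:E)
  (fun x => (normc (v x))%:E)).
- apply: lte_mul_pinfty => //.
  + by apply: integral_ge0 => x _; rewrite lee_fin normc_ge0.
  + rewrite ge0_fin_numE//.
    by apply: integral_ge0 => x _; rewrite lee_fin normc_ge0.
- exact/measurable_EFinP/measurable_normc.
- exact/measurable_EFinP/measurable_normc.
- by move=> x; rewrite lee_fin normc_ge0.
- by move=> x; rewrite lee_fin normc_ge0.
Qed.

Lemma cintegral_tensor (u : T1 -> R[i]) (v : T2 -> R[i]) :
  cintegrable m1 u -> cintegrable m2 v ->
  cintegral (m1 \x m2)%E (fun p => u p.1 * v p.2) =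
  cintegral m1 u * cintegral m2 v.
Proof.
move=> iu iv; have [_ _ _ ->] := cintegral_fubini (cintegrable_tensor iu iv).
under eq_fun do rewrite /= cintegralZ// mulrC.
by rewrite cintegralZ// mulrC.
Qed.

End ProductsSwap.

(** * The Haar measure and its scaling invariance *)

Section HaarMeasure.
Variable R : realType.
Local Notation RR := (measurableTypeR R).
Local Notation leb := (@lebesgue_measure R).
Local Notation mu := (haar R).

Lemma measurable_invr : measurable_fun setT (fun x : RR => x^-1 : RR).
Proof.
rewrite (_ : (fun x => _) = (fun x : RR => x * (x ^+ 2) `^ (-1))).
  apply: measurable_funM => //.
  apply: (measurableT_comp (measurable_powR (-1))).
  exact: measurable_funX.
apply/funext => x; rewrite powR_inv1 ?sqr_ge0//.
have [->|x0] := eqVneq x 0; first by rewrite invr0 mul0r.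
by field.
Qed.

Lemma measurable_norm_inv : measurable_fun setT (fun x : RR => `|x|^-1 : R).
Proof. apply: (measurableT_comp measurable_invr); exact: normr_measurable. Qed.

Import HBNNSimple.

(** The Haar measure is defined by a density, so the identity holds for
    indicators, and monotone approximation by simple functions does the rest. *)
Lemma haar_integral (f : RR -> \bar R) : measurable_fun setT f ->
  (forall x, 0 <= f x)%E ->
  (\int[mu]_x f x = \int[leb]_x (f x * (`|x|^-1)%:E))%E.
Proof.
move=> mf f0; pose h := nnsfun_approx measurableT mf.
have mi : measurable_fun setT (fun x : RR => (`|x|^-1)%:E).
  by apply/measurable_EFinP; exact: measurable_norm_inv.
have hf x : (h n x)%:E @[n --> \oo] --> f x.
  by apply: cvg_nnsfun_approx => // y _; exact: f0.
have nd x : nondecreasing_seq (fun n => (h n x)%:E).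
  by move=> a b ab; rewrite lee_fin; exact/lefP/nd_nnsfun_approx.
transitivity (limn (fun n => \int[mu]_x (h n x)%:E)%E).
  rewrite -monotone_convergence//.
  - by apply: eq_integral => x _; apply/esym/cvg_lim => //; exact: hf.
  - by move=> n; exact/measurable_EFinP.
  - by move=> n x _; rewrite lee_fin.
transitivity (limn (fun n => \int[leb]_x ((h n x)%:E * (`|x|^-1)%:E))%E); last first.
  rewrite -monotone_convergence//.
  - apply: eq_integral => x _; apply/cvg_lim => //.
    by apply: cvgeZr => //; exact: hf.
  - by move=> n; apply: emeasurable_funM => //; exact/measurable_EFinP.
  - by move=> n x _; rewrite mule_ge0// lee_fin ?invr_ge0.
  - by move=> x _ a b ab; rewrite lee_wpmul2r ?lee_fin ?invr_ge0//; exact: nd.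
congr (limn _); apply/funext => n.
have mind y : measurable_fun setT (fun x : RR => (y * \1_(h n @^-1` [set y]) x)%:E).
  by apply/measurable_EFinP; exact: measurable_funM.
transitivity (\int[mu]_x (\sum_(y \in range (h n)) (y * \1_(h n @^-1` [set y]) x)%:E))%E.
  by apply: eq_integral => t tE; rewrite /= fimfunE -fsumEFin.
transitivity (\int[leb]_x (\sum_(y \in range (h n)) ((y * \1_(h n @^-1` [set y]) x)%:E * (`|x|^-1)%:E)))%E; last first.
  apply: eq_integral => t tE; rewrite fimfunE -fsumEFin//.
  by rewrite ge0_mule_fsuml// => y; exact: nnfun_muleindic_ge0.
rewrite !ge0_integral_fsum//; last 3 first.
- by move=> y; apply: emeasurable_funM.
- by move=> y x _; rewrite mule_ge0 ?nnfun_muleindic_ge0// lee_fin invr_ge0.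
- by move=> y x _; exact: nnfun_muleindic_ge0.
apply: eq_fsbigr => y; rewrite inE => -[x _ xy].
have y0 : 0 <= y by rewrite -xy.
have mS : measurable (h n @^-1` [set y]) by [].
under eq_integral do rewrite EFinM.
under [RHS]eq_integral do rewrite EFinM -muleA.
rewrite !ge0_integralZl//;
  try (by apply/measurable_EFinP);
  try (by apply: emeasurable_funM => //; apply/measurable_EFinP);
  try (by move=> t _; rewrite mule_ge0// lee_fin ?invr_ge0).
congr (_ * _)%E; rewrite integral_indic// setIT.
transitivity (\int[leb]_(t in h n @^-1` [set y]) (`|t|^-1)%:E)%E; first by [].
rewrite [LHS]integral_mkcond; apply: eq_integral => t _.
by rewrite patchE indicE; case: ifPn => _; rewrite ?mul1e ?mul0e.
Qed.

Lemma ae_neq (a : R) : {ae leb, forall x : RR, x != a}.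
Proof.
exists [set a]; split => //; first exact: lebesgue_measure_set1.
by move=> x /= /negP; rewrite negbK => /eqP.
Qed.

Lemma ae_haar (P : RR -> Prop) : {ae leb, forall x, P x} -> {ae mu, forall x, P x}.
Proof.
move=> [A [mA A0 PA]]; exists A; split => //.
apply: null_set_integral => //.
by apply/measurable_funTS/measurable_EFinP; exact: measurable_norm_inv.
Qed.

Lemma haar_ae_neq (a : R) : {ae mu, forall x : RR, x != a}.
Proof. exact/ae_haar/ae_neq. Qed.

Lemma haar_cintegrableP (f : RR -> R[i]) : cmeasurable f ->
  (cintegrable leb (fun x => f x * (`|x|^-1)%:C) <-> cintegrable mu f).
Proof.
move=> mf; have E : (\int[leb]_x (normc (f x * (`|x|^-1)%:C))%:E =
    \int[mu]_x (normc (f x))%:E)%E.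
  rewrite haar_integral//.
  - by apply: eq_integral => x _;
      rewrite Normc.normcM normc_real ger0_norm ?invr_ge0// EFinM.
  - exact/measurable_EFinP/measurable_normc.
  - by move=> x; rewrite lee_fin normc_ge0.
split => [[_ fo]|[_ fo]]; split => //; rewrite -?E// ?E//.
by apply: cmeasurableM => //; apply: cmeasurable_real; exact: measurable_norm_inv.
Qed.

Lemma haar_cintegral (f : RR -> R[i]) : cmeasurable f ->
  cintegral mu f = cintegral leb (fun x => f x * (`|x|^-1)%:C).
Proof.
move=> [mf1 mf2].
have aux (h : RR -> R) : measurable_fun setT h ->
    (\int[mu]_x (h x)%:E = \int[leb]_x (h x * `|x|^-1)%:E)%E.
  move=> mh; rewrite integralE [RHS]integralE.
  have mh' : measurable_fun setT (fun x => (h x)%:E) by exact/measurable_EFinP.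
  rewrite !haar_integral//; [|exact: measurable_funeneg|exact: measurable_funepos].
  congr (_ - _)%E; apply: eq_integral => x _.
    by rewrite !funeposE maxe_pMl ?lee_fin ?invr_ge0// mul0e.
  by rewrite !funenegE maxe_pMl ?lee_fin ?invr_ge0// mul0e EFinM mulNe.
apply: complex_ext => /=; congr fine; rewrite aux//; apply: eq_integral => x _;
  by rewrite ?cReM ?cImM/= mulr0 ?subr0 ?add0r.
Qed.

Lemma lebesgue_translation (c : R) : measure_preserving leb leb (fun x : RR => x + c).
Proof.
have mt : measurable_fun setT (fun x : RR => x + c : RR) by exact: measurable_funD.
split => // A mA; apply/esym.
apply: (lebesgue_measure_unique (mu := image_measure leb mt)) => // _ [[a b] _ <-].
rewrite image_measureE (_ : _ @^-1` _ = `]a - c, b - c]%classic).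
  rewrite lebesgue_measure_itv; apply: etrans (esym (lebesgue_measure_itv _)).
  rewrite /= !lte_fin ltrD2r.
  by case: ifPn => // _; rewrite -!EFinB; congr EFin; lra.
by apply/seteqP; split => x /=; rewrite !in_itv/= ltrBlDr lerBrDr.
Qed.

Lemma lebesgue_opp : measure_preserving leb leb (fun x : RR => - x).
Proof.
by split => [|A mA]; [exact: oppr_measurable|exact: lebesgue_measureN].
Qed.

(** For r > 0 the scaled image of Lebesgue measure has the right values on
    half-open intervals; the reflection handles r < 0. *)
Lemma lebesgue_scale (r : R) (f : RR -> \bar R) : r != 0 ->
  measurable_fun setT f -> (forall x, 0 <= f x)%E ->
  (\int[leb]_x f x = `|r|%R%:E * \int[leb]_x f (r * x)%R)%E.
Proof.
have pos (q : R) (g : RR -> \bar R) : 0 < q ->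
    measurable_fun setT g -> (forall x, 0 <= g x)%E ->
    (\int[leb]_x g x = q%:E * \int[leb]_x g (q * x)%R)%E.
  move=> q0 mg g0.
  have mq : measurable_fun setT (fun x : RR => q * x : RR) by exact: measurable_funM.
  have := @ge0_integral_pushforward _ _ _ _ _ _ mq leb setT g measurableT mg.
  rewrite preimage_setT => /= <-//.
  pose q' := NngNum (ltW q0).
  rewrite -[q in RHS]/(q'%:num).
  rewrite -(ge0_integral_mscale (image_measure leb mq) measurableT q')//.
  apply: eq_measure_integral => A mA _.
  apply: (lebesgue_measure_unique (mu := mscale q' (image_measure leb mq))) => // _ [[a b] _ <-].
  have pre : (fun x : RR => q * x) @^-1` `]a, b]%classic = `]a / q, b / q]%classic.
    by apply/seteqP; split => x /=;
      rewrite !in_itv/= ltr_pdivrMr// ler_pdivlMr// [x * q]mulrC.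
  transitivity (q%:E * leb `](a / q)%R, (b / q)%R]%classic)%E; last by rewrite -pre.
  rewrite !lebesgue_measure_itv/= !lte_fin ltr_pM2r ?invr_gt0//.
  case: ifPn => // _; rewrite ?mule0// -?EFinB -?EFinM; congr EFin.
  by field; rewrite gt_eqF.
move=> rn0 mf f0; have [r0|r0|r0] := ltgtP r 0; last by rewrite r0 eqxx in rn0.
  2: by rewrite gtr0_norm//; exact: pos.
rewrite ltr0_norm//.
have mn : measurable_fun setT (fun x : RR => f (- x)).
  by apply: (measurableT_comp mf); exact: oppr_measurable.
rewrite [LHS](preserving_integral lebesgue_opp)//.
rewrite [LHS](pos (- r) (fun x => f (- x)))// ?oppr_gt0//.
by under eq_integral do rewrite /= mulNr opprK.
Qed.

(** The Jacobian |r| of the scaling cancels against the density 1/|t|. *)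
Lemma haar_scale (r : R) : r != 0 -> measure_preserving mu mu (fun x : RR => r * x).
Proof.
move=> r0; have mr : measurable_fun setT (fun x : RR => r * x : RR).
  exact: measurable_funM.
split => // A mA.
rewrite -[in LHS](setIT (_ @^-1` _)) -integral_indic//; last first.
  by rewrite -[X in measurable X]setTI; exact: mr.
rewrite -[in RHS](setIT A) -integral_indic//.
have mA' : measurable_fun setT (fun x : RR => (\1_A x)%:E : \bar R).
  exact/measurable_EFinP.
have mn : measurable_fun setT (fun x : RR => (`|x|^-1)%:E : \bar R).
  by apply/measurable_EFinP; exact: measurable_norm_inv.
rewrite !haar_integral//; last first.
  by apply/measurable_EFinP/measurable_indic; rewrite -[X in measurable X]setTI; exact: mr.
have mp : measurable_fun setT (fun x : RR => (\1_A x)%:E * (`|x|^-1)%:E)%E.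
  exact: (emeasurable_funM mA' mn).
have p0 (x : RR) : (0 <= (\1_A x)%:E * (`|x|^-1)%:E)%E.
  by rewrite mule_ge0// lee_fin// invr_ge0.
rewrite [RHS](lebesgue_scale r0 mp p0).
rewrite -ge0_integralZl//; last exact: (measurableT_comp mp).
apply: eq_integral => x _.
have -> : \1_([eta *%R r] @^-1` A) x = \1_A (r * x) :> R.
  by rewrite !indicE; congr (_%:R); congr nat_of_bool; apply/idP/idP; rewrite !inE.
rewrite -!EFinM normrM invfM [in RHS]mulrCA (mulrA `|r|) mulfV ?mul1r//.
by rewrite normr_eq0.
Qed.

End HaarMeasure.

(** * Inversion and the substitution h = u / (1 - u) *)

Section HaarInversion.
Variable R : realType.
Local Notation RR := (measurableTypeR R).
Local Notation leb := (@lebesgue_measure R).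
Local Notation mu := (haar R).

(** A positive function off 0 of total mass one for dt/|t|: the density |t|
    cancels and leaves the normal distribution. *)
Definition gauss (t : RR) : R := `|t| * normal_pdf 0 1 t.

Lemma gauss_ge0 t : 0 <= gauss t.
Proof. by rewrite mulr_ge0// normal_pdf_ge0. Qed.

Lemma gauss_gt0 t : t != 0 -> 0 < gauss t.
Proof.
move=> t0; rewrite mulr_gt0 ?normr_gt0// normal_pdfE ?oner_eq0//.
by rewrite mulr_gt0 ?normal_peak_gt0 ?oner_eq0// expR_gt0.
Qed.

Lemma measurable_gauss : measurable_fun setT gauss.
Proof.
apply: measurable_funM; first exact: normr_measurable.
exact: measurable_normal_pdf.
Qed.

Lemma integral_gauss : (\int[mu]_t (gauss t)%:E = 1)%E.
Proof.
rewrite haar_integral; last 2 first.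
- by apply/measurable_EFinP; exact: measurable_gauss.
- by move=> x; rewrite lee_fin gauss_ge0.
rewrite -(integral_normal_pdf 0 (1 : R)); apply: ge0_ae_eq_integral => //.
- apply: emeasurable_funM; apply/measurable_EFinP; first exact: measurable_gauss.
  exact: measurable_norm_inv.
- by apply/measurable_EFinP; exact: measurable_normal_pdf.
- by move=> x _; rewrite mule_ge0// lee_fin ?gauss_ge0 ?invr_ge0.
- by move=> x _; rewrite lee_fin normal_pdf_ge0.
- apply: filterS (ae_neq (0 : R)) => x x0 _; rewrite -EFinM; congr EFin.
  by rewrite /gauss mulrAC mulfV ?mul1r// normr_eq0.
Qed.

Lemma haar_scale_integral (r : R) (f : RR -> \bar R) : r != 0 ->
  measurable_fun setT f -> (forall x, 0 <= f x)%E ->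
  (\int[mu]_x f (r * x)%R = \int[mu]_x f x)%E.
Proof. by move=> r0 mf f0; rewrite -(preserving_integral (haar_scale r0)). Qed.

(** Inversion preserves the Haar measure because the group is commutative: for
    a probability density g, Fubini and the scaling invariance turn
    the product of the integrals of f and g into that of the integrals of
    f (1/x) and g. *)
Lemma haar_inv_integral (f : RR -> \bar R) :
  measurable_fun setT f -> (forall x, 0 <= f x)%E ->
  (\int[mu]_x f x = \int[mu]_x f (x^-1)%R)%E.
Proof.
move=> mf f0; pose g t := (gauss t)%:E : \bar R.
have mg : measurable_fun setT g.
  by apply/measurable_EFinP; exact: measurable_gauss.
have g0 x : (0 <= g x)%E by rewrite lee_fin gauss_ge0.
have m1 : measurable_fun setT (fst : RR * RR -> RR) by exact: measurable_fst.
have m2 : measurable_fun setT (snd : RR * RR -> RR) by exact: measurable_snd.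
have mi := @measurable_invr R.
have mfi : measurable_fun setT (fun x : RR => f x^-1) by exact: (measurableT_comp mf).
have mm : measurable_fun setT (fun p : RR * RR => p.1 * p.2 : RR).
  exact: measurable_funM.
have mq : measurable_fun setT (fun p : RR * RR => p.2^-1 * p.1 : RR).
  by apply: measurable_funM => //; exact: (measurableT_comp mi).
have nn (I J : \bar R) : (0 <= I -> 0 <= J -> 0 <= I * J)%E by exact: mule_ge0.
have mS (h k : RR -> \bar R) : measurable_fun setT h -> measurable_fun setT k ->
    forall phi psi : RR * RR -> RR, measurable_fun setT phi -> measurable_fun setT psi ->
    measurable_fun setT (fun p => h (phi p) * k (psi p))%E.
  move=> mh mk phi psi mphi mpsi; apply: emeasurable_funM.
    exact: (measurableT_comp mh).
  exact: (measurableT_comp mk).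
have aeq (h k : RR -> \bar R) : measurable_fun setT h -> measurable_fun setT k ->
    (forall x, 0 <= h x)%E -> (forall x, 0 <= k x)%E ->
    (forall x, x != 0 -> h x = k x) -> (\int[mu]_x h x = \int[mu]_x k x)%E.
  move=> mh mk h0 k0 hk; apply: ge0_ae_eq_integral => //.
  by apply: filterS (haar_ae_neq (0 : R)) => x x0 _; exact: hk.
have mT1 (F : RR * RR -> \bar R) : measurable_fun setT F -> (forall p, 0 <= F p)%E ->
    measurable_fun setT (fun x => \int[mu]_y F (x, y))%E.
  by move=> mF F0; exact: (measurable_fun_fubini_tonelli_F F).
have mT2 (F : RR * RR -> \bar R) : measurable_fun setT F -> (forall p, 0 <= F p)%E ->
    measurable_fun setT (fun y => \int[mu]_x F (x, y))%E.
  by move=> mF F0; exact: (measurable_fun_fubini_tonelli_G F).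
transitivity (\int[mu]_x \int[mu]_y (f x * g (x * y)%R))%E.
  apply: aeq => //.
  - exact: (mT1 (fun p => f p.1 * g (p.1 * p.2)%R)%E (mS _ _ mf mg _ _ m1 mm) (fun p => nn _ _ (f0 _) (g0 _))).
  - by move=> x; apply: integral_ge0 => y _; exact: nn.
  - move=> x x0; rewrite ge0_integralZl//.
      by rewrite haar_scale_integral// integral_gauss mule1.
    exact: (measurableT_comp mg (measurable_funM (measurable_cst x) (@measurable_id _ _ _))).
apply: etrans (fubini_tonelli (m1 := mu) (m2 := mu)
  (fun p : RR * RR => f p.1 * g (p.1 * p.2)%R)%E (mS _ _ mf mg _ _ m1 mm)
  (fun p => nn _ _ (f0 _) (g0 _))) _ => /=.
transitivity (\int[mu]_y \int[mu]_x (f (y^-1 * x)%R * g x))%E.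
  apply: aeq.
  - exact: (mT2 (fun p => f p.1 * g (p.1 * p.2)%R)%E (mS _ _ mf mg _ _ m1 mm) (fun p => nn _ _ (f0 _) (g0 _))).
  - exact: (mT2 (fun p => f (p.2^-1 * p.1)%R * g p.1)%E (mS _ _ mf mg _ _ mq m1) (fun p => nn _ _ (f0 _) (g0 _))).
  - by move=> x; apply: integral_ge0 => y _; exact: nn.
  - by move=> x; apply: integral_ge0 => y _; exact: nn.
  - move=> y y0.
    rewrite -(@haar_scale_integral y^-1 (fun x => f x * g (x * y)%R)%E) ?invr_eq0//.
    + by apply: eq_integral => x _; rewrite mulrAC mulVf// mul1r.
    + apply: emeasurable_funM => //; apply: (measurableT_comp mg).
      exact: measurable_funM.
    + by move=> x; exact: nn.
apply: etrans (esym (fubini_tonelli (m1 := mu) (m2 := mu)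
  (fun p : RR * RR => f (p.2^-1 * p.1)%R * g p.1)%E (mS _ _ mf mg _ _ mq m1)
  (fun p => nn _ _ (f0 _) (g0 _)))) _ => /=.
transitivity (\int[mu]_x (\int[mu]_y f (y^-1)%R * g x))%E; last first.
  by rewrite ge0_integralZl// ?integral_gauss ?mule1//; exact: integral_ge0.
apply: aeq => //.
- exact: (mT1 (fun p => f (p.2^-1 * p.1)%R * g p.1)%E (mS _ _ mf mg _ _ mq m1) (fun p => nn _ _ (f0 _) (g0 _))).
- exact: emeasurable_funM.
- by move=> x; apply: integral_ge0 => y _; exact: nn.
- by move=> x; rewrite nn//; exact: integral_ge0.
- move=> x x0; rewrite ge0_integralZr//; last first.
    apply: (measurableT_comp mf); exact: measurable_funM.
  congr (_ * _)%E.
  rewrite -(@haar_scale_integral x (fun y => f (y^-1 * x)%R))//.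
  + by apply: eq_integral => y _; rewrite invfM mulrAC mulVf// mul1r.
  + apply: (measurableT_comp mf); exact: measurable_funM.
Qed.

Lemma haar_inv : measure_preserving mu mu (fun x : RR => x^-1).
Proof.
split; first exact: measurable_invr.
move=> A mA.
have mA' : measurable ((fun x : RR => x^-1) @^-1` A).
  by rewrite -[X in measurable X]setTI; exact: measurable_invr.
rewrite -[in LHS](setIT (_ @^-1` _)) -integral_indic//.
rewrite -[in RHS](setIT A) -integral_indic//.
by rewrite [RHS]haar_inv_integral//; apply/measurable_EFinP.
Qed.

(** The substitution h = u / (1 - u) is the composite of the translation
    h = x - 1, the inversion x = 1 / y and the reflection y = 1 - u. *)
Lemma lebesgue_moebius (F : RR -> R[i]) : cintegrable leb F ->
  cintegrable leb (fun u => F ((1 - u)^-1 - 1) * (`|1 - u|^-1 * `|1 - u|^-1)%:C) /\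
  cintegral leb F =
  cintegral leb (fun u => F ((1 - u)^-1 - 1) * (`|1 - u|^-1 * `|1 - u|^-1)%:C).
Proof.
move=> iF; have tr := @lebesgue_translation R (- 1).
have i1 := preserving_cintegrable tr iF.
pose H (x : RR) := F (x - 1) * `|x|%:C.
have mH : cmeasurable H.
  apply: cmeasurableM; first exact: cmeasurable_integrable i1.
  by apply: cmeasurable_real; exact: normr_measurable.
have mHi : cmeasurable (fun x : RR => H x * (`|x|^-1)%:C).
  apply: cmeasurableM => //.
  by apply: cmeasurable_real; exact: measurable_norm_inv.
have HF : {ae leb, forall x : RR, F (x - 1) = H x * (`|x|^-1)%:C}.
  apply: filterS (ae_neq (0 : R)) => x x0.
  by rewrite /H -mulrA -rmorphM mulfV ?rmorph1 ?mulr1// normr_eq0.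
have iH : cintegrable mu H.
  by apply/haar_cintegrableP => //; exact: ae_cintegrable HF i1.
have iHi := preserving_cintegrable haar_inv iH.
have mHV : cmeasurable (fun x : RR => H x^-1) by exact: cmeasurable_integrable iHi.
have iK := (haar_cintegrableP mHV).2 iHi.
have onem : measure_preserving leb leb (fun u : RR => 1 - u).
  have := measure_preserving_comp (@lebesgue_opp R) (@lebesgue_translation R 1).
  by rewrite (_ : _ \o _ = (fun u : RR => 1 - u))//; apply/funext => u /=; rewrite addrC.
have i2 := preserving_cintegrable onem iK.
have E u : H (1 - u)^-1 * (`|1 - u|^-1)%:C =
    F ((1 - u)^-1 - 1) * (`|1 - u|^-1 * `|1 - u|^-1)%:C.
  by rewrite /H -mulrA -rmorphM normfV.
under [X in cintegrable _ X]eq_fun do rewrite -E.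
under [X in _ /\ _ = cintegral _ X]eq_fun do rewrite -E.
split => //; rewrite (preserving_cintegral tr iF).
rewrite (ae_eq_cintegral _ mHi HF); last exact: cmeasurable_integrable i1.
rewrite -haar_cintegral// (preserving_cintegral haar_inv iH) haar_cintegral//.
exact: (preserving_cintegral onem iK).
Qed.

End HaarInversion.

(** * The estimate behind absolute convergence *)

(** Obtained from the inequality between arithmetic and geometric means,
    weighted so that both squares contribute equally. *)
Lemma cauchy_schwarz_ge0 d (T : measurableType d) (R : realType)
    (mu : {measure set T -> \bar R}) (f g : T -> R) (X Y : R) :
  measurable_fun setT f -> measurable_fun setT g ->
  (forall x, 0 <= f x) -> (forall x, 0 <= g x) -> 0 <= X -> 0 <= Y ->
  (\int[mu]_x (f x ^+ 2)%:E <= (X ^+ 2)%:E)%E ->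
  (\int[mu]_x (g x ^+ 2)%:E <= (Y ^+ 2)%:E)%E ->
  (\int[mu]_x (f x * g x)%:E <= (X * Y)%:E)%E.
Proof.
move=> mf mg f0 g0 X0 Y0 fX gY.
have mf2 : measurable_fun setT (fun x => (f x ^+ 2)%:E).
  by apply/measurable_EFinP; exact: measurable_funX.
have mg2 : measurable_fun setT (fun x => (g x ^+ 2)%:E).
  by apply/measurable_EFinP; exact: measurable_funX.
have pos (A B : R) : 0 < A -> 0 < B -> X <= A -> Y <= B ->
    (\int[mu]_x (f x * g x)%:E <= (A * B)%:E)%E.
  move=> A0 B0 XA YB; pose c := B / A / 2; pose c' := A / B / 2.
  have c0 : 0 <= c by rewrite !divr_ge0// ltW.
  have c'0 : 0 <= c' by rewrite !divr_ge0// ltW.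
  apply: (@le_trans _ _ (\int[mu]_x (c%:E * (f x ^+ 2)%:E + c'%:E * (g x ^+ 2)%:E))%E).
    apply: ge0_le_integral => //.
    - by move=> x _; rewrite lee_fin mulr_ge0.
    - by apply/measurable_EFinP; exact: measurable_funM.
    - by apply: emeasurable_funD; apply: emeasurable_funM.
    - move=> x _; rewrite -!EFinM -EFinD lee_fin -subr_ge0.
      rewrite (_ : _ - _ = (f x * B - g x * A) ^+ 2 / (2 * A * B)).
        by rewrite divr_ge0 ?sqr_ge0// !mulr_ge0// ltW.
      by rewrite /c /c'; field; rewrite !gt_eqF.
  rewrite ge0_integralD//; last 4 first.
  - by move=> x _; rewrite mule_ge0// lee_fin// sqr_ge0.
  - exact: emeasurable_funM.
  - by move=> x _; rewrite mule_ge0// lee_fin// sqr_ge0.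
  - exact: emeasurable_funM.
  rewrite !ge0_integralZl//; try (by move=> x _; rewrite lee_fin sqr_ge0).
  apply: (@le_trans _ _ (c%:E * (X ^+ 2)%:E + c'%:E * (Y ^+ 2)%:E)%E).
    by apply: leeD; apply: lee_wpmul2l => //; rewrite lee_fin.
  rewrite -!EFinM -EFinD lee_fin.
  apply: (@le_trans _ _ (c * A ^+ 2 + c' * B ^+ 2)).
    apply: lerD; apply: ler_wpM2l => //; rewrite ler_pXn2r// nnegrE ?(ltW A0) ?(ltW B0)//.
  by rewrite le_eqVlt; apply/orP; left; apply/eqP; rewrite /c /c'; field; rewrite !gt_eqF.
apply/lee_addgt0Pr => e e0.
(* the weights above divide by X and Y, which may vanish: enlarge both by k *)
pose k := Num.min 1 (e / (X + Y + 1)).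
have D0 : 0 < X + Y + 1 by lra.
have k0 : 0 < k by rewrite lt_min ltr01 divr_gt0.
have k1 : k <= 1 by rewrite ge_min lexx.
have ke : k * (X + Y + 1) <= e by rewrite -ler_pdivlMr// ge_min lexx orbT.
apply: (le_trans (pos (X + k) (Y + k) _ _ _ _)); [lra|lra|lra|lra|].
rewrite -EFinD lee_fin; have : k * k <= k by rewrite ler_piMr// ltW.
by lra.
Qed.

Section HaarSquare.
Variable R : realType.
Local Notation RR := (measurableTypeR R).

(** The product measure under a name of its own, so that it can itself be a
    factor of the product on triples (h, (s, t)). *)
Definition haar2 : set (RR * RR) -> \bar R := (haar R \x haar R)%E.

HB.instance Definition _ := Measure.on haar2.

Let haar2_sigma_finite : sigma_finite setT haar2.
Proof.
by have [] := lebesgue_integral_fubini.measure_function_Measure_isSigmaFinite__to__measure_function_isSigmaFinite (haar R) (haar R).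
Qed.

HB.instance Definition _ := Measure_isSigmaFinite.Build _ _ _ haar2
  haar2_sigma_finite.

Lemma haar2_ae_fst (P : RR -> Prop) : {ae haar R, forall x, P x} ->
  {ae haar2, forall p, P p.1}.
Proof. exact: (@ae_fst _ _ RR RR R (haar R) (haar R)). Qed.

Lemma haar2_ae_snd (P : RR -> Prop) : {ae haar R, forall x, P x} ->
  {ae haar2, forall p, P p.2}.
Proof. exact: (@ae_snd _ _ RR RR R (haar R) (haar R)). Qed.

Lemma haar2_cintegrable_tensor (u v : RR -> R[i]) :
  cintegrable (haar R) u -> cintegrable (haar R) v ->
  cintegrable haar2 (fun p => u p.1 * v p.2).
Proof. exact: (@cintegrable_tensor _ _ RR RR R (haar R) (haar R)). Qed.

Lemma haar2_cintegral_tensor (u v : RR -> R[i]) :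
  cintegrable (haar R) u -> cintegrable (haar R) v ->
  cintegral haar2 (fun p => u p.1 * v p.2) =
  cintegral (haar R) u * cintegral (haar R) v.
Proof. exact: (@cintegral_tensor _ _ RR RR R (haar R) (haar R)). Qed.

Lemma haar2_integral_tensor (u v : RR -> \bar R) :
  measurable_fun setT u -> measurable_fun setT v ->
  (forall x, 0 <= u x)%E -> (forall y, 0 <= v y)%E ->
  (\int[haar2]_p (u p.1 * v p.2) = \int[haar R]_x u x * \int[haar R]_y v y)%E.
Proof. exact: (@ge0_integral_tensor _ _ RR RR R (haar R) (haar R)). Qed.

Lemma haar2_scale (r : R) : r != 0 ->
  measure_preserving haar2 haar2 (fun p : RR * RR => (r * p.1, r * p.2) : RR * RR).
Proof.
move=> r0.
exact: (@prod_preserving _ _ RR RR R (haar R) (haar R) _ _ RR RR (haar R) (haar R)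
  _ _ (haar_scale r0) (haar_scale r0)).
Qed.

End HaarSquare.
Arguments haar2 : clear implicits.

Section KeyEstimate.
Variable R : realType.
Local Notation RR := (measurableTypeR R).
Local Notation mu := (haar R).
Local Notation nu := (haar2 R).

Lemma measurable_dilate : measurable_fun setT (fun p : RR * RR => p.2 / (1 + p.1) : RR).
Proof.
apply: measurable_funM; first exact: measurable_snd.
apply: (measurableT_comp (@measurable_invr R)).
by apply: measurable_funD => //; exact: measurable_fst.
Qed.

Lemma measurable_codilate :
  measurable_fun setT (fun p : RR * RR => p.1 * p.2 / (1 + p.1) : RR).
Proof.
apply: measurable_funM.
  by apply: measurable_funM; [exact: measurable_fst|exact: measurable_snd].
apply: (measurableT_comp (@measurable_invr R)).
by apply: measurable_funD => //; exact: measurable_fst.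
Qed.

Lemma neq0_onep (h : R) : h != -1 -> 1 + h != 0.
Proof. by move=> h1; rewrite addrC addr_eq0. Qed.

(** The change of variables behind every bound on dual convolution: after the
    dilation s = (1 + h) x the integrand is u (x) v (h x). *)
Lemma integral_dilate_codilate (u v : RR -> \bar R) :
  measurable_fun setT u -> measurable_fun setT v ->
  (forall x, 0 <= u x)%E -> (forall x, 0 <= v x)%E ->
  (\int[mu]_h \int[mu]_s (u (s / (1 + h))%R * v (h * s / (1 + h))%R) =
   \int[mu]_x u x * \int[mu]_x v x)%E.
Proof.
move=> m_u m_v u0 v0.
have m1 : measurable_fun setT (fun p : RR * RR => u (p.2 / (1 + p.1))%R * v (p.1 * p.2 / (1 + p.1))%R)%E.
  apply: emeasurable_funM; first exact: (measurableT_comp m_u measurable_dilate).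
  exact: (measurableT_comp m_v measurable_codilate).
have m2 : measurable_fun setT (fun p : RR * RR => u p.2 * v (p.1 * p.2)%R)%E.
  apply: emeasurable_funM; first exact: (measurableT_comp m_u measurable_snd).
  by apply: (measurableT_comp m_v); exact: measurable_funM.
have p0 (a b : RR) : (0 <= u a * v b)%E by rewrite mule_ge0.
transitivity (\int[mu]_h \int[mu]_s (u s * v (h * s)%R))%E.
  apply: ge0_ae_eq_integral => //.
  - by apply: (measurable_fun_fubini_tonelli_F (m2 := mu) _ m1) => p.
  - by apply: (measurable_fun_fubini_tonelli_F (m2 := mu) _ m2) => p.
  - by move=> h _; exact: integral_ge0.
  - by move=> h _; exact: integral_ge0.
  - apply: filterS (haar_ae_neq (-1 : R)) => h /neq0_onep h0 _.
    rewrite -(@haar_scale_integral _ (1 + h)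
      (fun s => u (s / (1 + h))%R * v (h * s / (1 + h))%R)%E) //.
    + apply: eq_integral => s _; congr (u _ * v _)%E; field; exact: h0.
    + exact: (measurableT_comp m1 (pair1_measurable h)).
apply: etrans (fubini_tonelli (m1 := mu) (m2 := mu)
  (fun p : RR * RR => u p.2 * v (p.1 * p.2)%R)%E m2 (fun p => p0 _ _)) _ => /=.
transitivity (\int[mu]_s (u s * \int[mu]_x v x))%E; last first.
  by rewrite ge0_integralZr//; exact: integral_ge0.
apply: ge0_ae_eq_integral => //.
- by apply: (measurable_fun_fubini_tonelli_G (m1 := mu) _ m2) => p.
- exact: emeasurable_funM.
- by move=> h _; exact: integral_ge0.
- by move=> h _; rewrite mule_ge0//; exact: integral_ge0.
- apply: filterS (haar_ae_neq (0 : R)) => s s0 _; rewrite ge0_integralZl//; last first.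
    by apply: (measurableT_comp m_v); exact: measurable_funM.
  congr (_ * _)%E; rewrite -(haar_scale_integral s0)//.
  by apply: eq_integral => h _; rewrite mulrC.
Qed.

(** The integrand, at (h, (s, t)), of the kernel of the dual convolution of two
    operators with kernels K1 and K2. *)
Definition twist (K1 K2 : RR * RR -> R[i]) (q : RR * (RR * RR)) : R[i] :=
  K1 (q.2.1 / (1 + q.1), q.2.2 / (1 + q.1)) *
  K2 (q.1 * q.2.1 / (1 + q.1), q.1 * q.2.2 / (1 + q.1)).

(** The integrand of the matrix coefficient <A a, b> of an operator A with
    kernel K. *)
Definition pairing (b a : RR -> R[i]) (K : RR * RR -> R[i]) (p : RR * RR) : R[i] :=
  (b p.1)^* * K p * a p.2.

Definition paired_twist (b a : RR -> R[i]) (K1 K2 : RR * RR -> R[i]) (q : RR * (RR * RR)) : R[i] :=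
  pairing b a (fun p => twist K1 K2 (q.1, p)) q.2.

Definition kernel2 (x y : RR -> R[i]) (p : RR * RR) : R[i] := x p.1 * (y p.2)^*.

Lemma measurable_dilate2 : measurable_fun setT
  (fun q : RR * (RR * RR) => (q.2.1 / (1 + q.1), q.2.2 / (1 + q.1)) : RR * RR).
Proof.
apply: measurable_fun_pair.
  apply: (measurableT_comp (f := fun p : RR * RR => p.2 / (1 + p.1) : RR)
    (g := fun q : RR * (RR * RR) => (q.1, q.2.1))).
    exact: measurable_dilate.
  by apply: measurable_fun_pair => //; apply: measurableT_comp.
apply: (measurableT_comp (f := fun p : RR * RR => p.2 / (1 + p.1) : RR)
  (g := fun q : RR * (RR * RR) => (q.1, q.2.2))).
  exact: measurable_dilate.
by apply: measurable_fun_pair => //; apply: measurableT_comp.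
Qed.

Lemma measurable_codilate2 : measurable_fun setT
  (fun q : RR * (RR * RR) =>
     (q.1 * q.2.1 / (1 + q.1), q.1 * q.2.2 / (1 + q.1)) : RR * RR).
Proof.
apply: measurable_fun_pair.
  apply: (measurableT_comp (f := fun p : RR * RR => p.1 * p.2 / (1 + p.1) : RR)
    (g := fun q : RR * (RR * RR) => (q.1, q.2.1))).
    exact: measurable_codilate.
  by apply: measurable_fun_pair => //; apply: measurableT_comp.
apply: (measurableT_comp (f := fun p : RR * RR => p.1 * p.2 / (1 + p.1) : RR)
  (g := fun q : RR * (RR * RR) => (q.1, q.2.2))).
  exact: measurable_codilate.
by apply: measurable_fun_pair => //; apply: measurableT_comp.
Qed.

Lemma cmeasurable_twist K1 K2 : cmeasurable K1 -> cmeasurable K2 ->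
  cmeasurable (twist K1 K2).
Proof.
move=> m1 m2; apply: cmeasurableM.
  exact: (cmeasurable_comp measurable_dilate2 m1).
exact: (cmeasurable_comp measurable_codilate2 m2).
Qed.

Lemma cmeasurable_pairing b a K : cmeasurable b -> cmeasurable a ->
  cmeasurable K -> cmeasurable (pairing b a K).
Proof.
move=> mb ma mK; apply: cmeasurableM; last first.
  exact: (cmeasurable_comp measurable_snd ma).
apply: cmeasurableM => //; apply: cmeasurable_conj.
exact: (cmeasurable_comp measurable_fst mb).
Qed.

Lemma cmeasurable_kernel2 x y : cmeasurable x -> cmeasurable y ->
  cmeasurable (kernel2 x y).
Proof.
move=> mx my; apply: cmeasurableM.
  exact: (cmeasurable_comp measurable_fst mx).
apply: cmeasurable_conj; exact: (cmeasurable_comp measurable_snd my).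
Qed.

Lemma cmeasurable_paired_twist b a K1 K2 : cmeasurable b -> cmeasurable a ->
  cmeasurable K1 -> cmeasurable K2 ->
  cmeasurable (paired_twist b a K1 K2).
Proof.
move=> mb ma m1 m2; rewrite /paired_twist /pairing.
have mt := cmeasurable_twist m1 m2.
apply: cmeasurableM; last first.
  exact: (cmeasurable_comp (measurableT_comp measurable_snd measurable_snd) ma).
apply: cmeasurableM; first apply: cmeasurable_conj.
  exact: (cmeasurable_comp (measurableT_comp measurable_fst measurable_snd) mb).
by rewrite (_ : (fun q => _) = twist K1 K2).
Qed.

(** Tonelli splits off the factor w; exchanging the roles of s and t gives the
    second identity. *)
Lemma integral_triple (u v w : RR -> \bar R) :
  measurable_fun setT u -> measurable_fun setT v -> measurable_fun setT w ->
  (forall x, 0 <= u x)%E -> (forall x, 0 <= v x)%E -> (forall x, 0 <= w x)%E ->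
  (\int[(mu \x nu)%E]_q (u (q.2.1 / (1 + q.1))%R * v (q.1 * q.2.1 / (1 + q.1))%R * w q.2.2) =
   \int[mu]_x u x * \int[mu]_x v x * \int[mu]_x w x)%E /\
  (\int[(mu \x nu)%E]_q (u (q.2.2 / (1 + q.1))%R * v (q.1 * q.2.2 / (1 + q.1))%R * w q.2.1) =
   \int[mu]_x u x * \int[mu]_x v x * \int[mu]_x w x)%E.
Proof.
move=> m_u m_v m_w u0 v0 w0.
have m1 : measurable_fun setT (fun p : RR * RR => u (p.2 / (1 + p.1))%R * v (p.1 * p.2 / (1 + p.1))%R)%E.
  apply: emeasurable_funM; first exact: (measurableT_comp m_u measurable_dilate).
  exact: (measurableT_comp m_v measurable_codilate).
have mF : measurable_fun setT (fun h : RR => \int[mu]_s (u (s / (1 + h))%R * v (h * s / (1 + h))%R))%E.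
  apply: (measurable_fun_fubini_tonelli_F (m2 := mu) _ m1) => p.
  by rewrite mule_ge0.
have mh (h : RR) : measurable_fun setT (fun s : RR => u (s / (1 + h))%R * v (h * s / (1 + h))%R)%E.
  exact: (measurableT_comp m1 (pair1_measurable h)).
have I0 : (0 <= \int[mu]_x w x)%E by exact: integral_ge0.
have main : (\int[mu]_h (\int[mu]_s (u (s / (1 + h))%R * v (h * s / (1 + h))%R) * \int[mu]_x w x)
    = \int[mu]_x u x * \int[mu]_x v x * \int[mu]_x w x)%E.
  rewrite ge0_integralZr//; first by rewrite integral_dilate_codilate.
  by move=> h _; apply: integral_ge0 => s _; rewrite mule_ge0.
split; rewrite -main.
  have mG : measurable_fun setT (fun q : RR * (RR * RR) =>
      u (q.2.1 / (1 + q.1))%R * v (q.1 * q.2.1 / (1 + q.1))%R * w q.2.2)%E.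
    apply: emeasurable_funM; last first.
      exact: (measurableT_comp m_w (measurableT_comp measurable_snd measurable_snd)).
    apply: (measurableT_comp m1 (g := fun q : RR * (RR * RR) => (q.1, q.2.1))).
    by apply: measurable_fun_pair => //; apply: measurableT_comp.
  apply: (etrans (fubini_tonelli1 (m1 := mu) (m2 := nu) _ mG _)).
    by move=> q; rewrite !mule_ge0.
  apply: eq_integral => h _; rewrite /fubini_F/=.
  by apply: (haar2_integral_tensor (mh h) m_w) => // s;
    rewrite mule_ge0.
have mG : measurable_fun setT (fun q : RR * (RR * RR) =>
    u (q.2.2 / (1 + q.1))%R * v (q.1 * q.2.2 / (1 + q.1))%R * w q.2.1)%E.
  apply: emeasurable_funM; last first.
    exact: (measurableT_comp m_w (measurableT_comp measurable_fst measurable_snd)).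
  apply: (measurableT_comp m1 (g := fun q : RR * (RR * RR) => (q.1, q.2.2))).
  by apply: measurable_fun_pair => //; apply: measurableT_comp.
apply: (etrans (fubini_tonelli1 (m1 := mu) (m2 := nu) _ mG _)).
  by move=> q; rewrite !mule_ge0.
apply: eq_integral => h _; rewrite /fubini_F/= [RHS]muleC.
under eq_integral do rewrite muleC.
by apply: (haar2_integral_tensor m_w (mh h)) => // s;
  rewrite mule_ge0.
Qed.

(** The Cauchy-Schwarz inequality on the product space separates the factors
    that depend on s from those that depend on t. *)
Lemma paired_twist_estimate (x y x' y' a b : L2Rx R) :
  (\int[(mu \x nu)%E]_q (normc (paired_twist b a (kernel2 x y) (kernel2 x' y') q))%:E
   <= (L2_norm x * L2_norm x' * L2_norm a * (L2_norm y * L2_norm y' * L2_norm b))%:E)%E.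
Proof.
pose N (z : L2Rx R) (t : RR) := normc (z t).
have mN z : measurable_fun setT (N z) by exact/measurable_normc/cmeasurable_L2.
have N0 z t : 0 <= N z t by exact: normc_ge0.
pose f (q : RR * (RR * RR)) :=
  N x (q.2.1 / (1 + q.1)) * N x' (q.1 * q.2.1 / (1 + q.1)) * N a q.2.2.
pose g (q : RR * (RR * RR)) :=
  N y (q.2.2 / (1 + q.1)) * N y' (q.1 * q.2.2 / (1 + q.1)) * N b q.2.1.
have mq1 : measurable_fun setT (fun q : RR * (RR * RR) => (q.1, q.2.1)).
  by apply: measurable_fun_pair => //; apply: measurableT_comp.
have mq2 : measurable_fun setT (fun q : RR * (RR * RR) => (q.1, q.2.2)).
  by apply: measurable_fun_pair => //; apply: measurableT_comp.
have mf : measurable_fun setT f.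
  apply: measurable_funM; last exact: (measurableT_comp (mN a) (measurableT_comp measurable_snd measurable_snd)).
  apply: measurable_funM.
    exact: (measurableT_comp (mN x) (measurableT_comp measurable_dilate mq1)).
  exact: (measurableT_comp (mN x') (measurableT_comp measurable_codilate mq1)).
have mg : measurable_fun setT g.
  apply: measurable_funM; last exact: (measurableT_comp (mN b) (measurableT_comp measurable_fst measurable_snd)).
  apply: measurable_funM.
    exact: (measurableT_comp (mN y) (measurableT_comp measurable_dilate mq2)).
  exact: (measurableT_comp (mN y') (measurableT_comp measurable_codilate mq2)).
have mN2 z : measurable_fun setT (fun t => (N z t ^+ 2)%:E).
  by apply/measurable_EFinP; exact: measurable_funX.
have N20 z t : (0 <= (N z t ^+ 2)%:E)%E by rewrite lee_fin sqr_ge0.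
rewrite (eq_integral (fun q => (f q * g q)%:E)); last first.
  move=> q _; congr EFin; rewrite /paired_twist /pairing /twist /kernel2 /f /g /N !Normc.normcM !normc_conj.
  by ring.
apply: cauchy_schwarz_ge0 => //.
- by move=> q; rewrite !mulr_ge0.
- by move=> q; rewrite !mulr_ge0.
- by rewrite !mulr_ge0 ?L2_norm_ge0.
- by rewrite !mulr_ge0 ?L2_norm_ge0.
- have [E _] := integral_triple (mN2 x) (mN2 x') (mN2 a) (N20 x) (N20 x') (N20 a).
  under eq_integral do rewrite /f !exprMn !EFinM.
  by rewrite E !exprMn !EFinM -!L2_norm_sqr.
- have [_ E] := integral_triple (mN2 y) (mN2 y') (mN2 b) (N20 y) (N20 y') (N20 b).
  under eq_integral do rewrite /g !exprMn !EFinM.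
  by rewrite E !exprMn !EFinM -!L2_norm_sqr.
Qed.

End KeyEstimate.

(** * Matrix coefficients and nuclear series *)

Section L2Theory.
Context d (T : measurableType d) (R : realType) (mu : {measure set T -> \bar R}).
Local Notation L2 := (L2 mu).
Implicit Types x y : L2.

Lemma L2_of_ae (f : T -> R[i]) : square_integrable mu f ->
  {ae mu, forall t, (L2_of mu f : L2) t = f t}.
Proof.
move=> sf; have := pi_L2_ae (insubd (0 : L2fun mu) f).
apply: filterS => t ->; rewrite -[X in X t = _]/(val _) insubdK//.
exact/L2predP.
Qed.

Lemma integral_normM_L2 x y :
  (\int[mu]_t (normc (x t) * normc (y t))%:E <= (L2_norm x * L2_norm y)%:E)%E.
Proof.
apply: cauchy_schwarz_ge0; rewrite ?L2_norm_ge0//.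
- exact/measurable_normc/cmeasurable_L2.
- exact/measurable_normc/cmeasurable_L2.
- by move=> t; exact: normc_ge0.
- by move=> t; exact: normc_ge0.
- by rewrite L2_norm_sqr.
- by rewrite L2_norm_sqr.
Qed.

Lemma cintegrable_innerL2 x y : cintegrable mu (fun t => x t * (y t)^*).
Proof.
apply: (@cintegrable_le _ _ _ _ _ (fun t => normc (x t) * normc (y t))).
- by apply: cmeasurableM; [|apply: cmeasurable_conj]; exact: cmeasurable_L2.
- by apply: measurable_funM; apply: measurable_normc; exact: cmeasurable_L2.
- by move=> t; rewrite Normc.normcM normc_conj.
- exact: le_lt_trans (integral_normM_L2 x y) (ltry _).
Qed.

Lemma L2_inner_le x y : normc (L2_inner x y) <= 2 * (L2_norm x * L2_norm y).
Proof.
rewrite -lee_fin EFinM; apply: le_trans (cintegral_norm_le (cintegrable_innerL2 x y)) _.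
apply: lee_wpmul2l => //.
by under eq_integral do rewrite Normc.normcM normc_conj; exact: integral_normM_L2.
Qed.

Let ae_innerL2 x y (f : T -> R[i]) : cmeasurable f ->
  {ae mu, forall t, x t = f t} -> L2_inner x y = cintegral mu (fun t => f t * (y t)^*).
Proof.
move=> mf xf; apply: ae_eq_cintegral.
- exact: cmeasurable_integrable (cintegrable_innerL2 x y).
- by apply: cmeasurableM => //; apply: cmeasurable_conj; exact: cmeasurable_L2.
- by apply: filterS xf => t ->.
Qed.

Lemma L2_innerDl x x' y : L2_inner (x + x') y = L2_inner x y + L2_inner x' y.
Proof.
rewrite (ae_innerL2 _ (cmeasurableD (cmeasurable_L2 x) (cmeasurable_L2 x')) (L2_addE x x')).
rewrite -cintegralD; [|exact: cintegrable_innerL2..].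
by congr cintegral; apply/funext => t; rewrite mulrDl.
Qed.

Lemma L2_innerZl (c : R[i]) x y : L2_inner (c *: x) y = c * L2_inner x y.
Proof.
rewrite (ae_innerL2 _ (cmeasurableZ c (cmeasurable_L2 x)) (L2_scaleE c x)).
rewrite -cintegralZ; last exact: cintegrable_innerL2.
by congr cintegral; apply/funext => t; rewrite mulrA.
Qed.

Lemma L2_innerNl x y : L2_inner (- x) y = - L2_inner x y.
Proof. by rewrite -scaleN1r L2_innerZl mulN1r. Qed.

Lemma L2_innerBl x x' y : L2_inner (x - x') y = L2_inner x y - L2_inner x' y.
Proof. by rewrite L2_innerDl L2_innerNl. Qed.

Lemma L2_inner_suml I (r : seq I) (F : I -> L2) y :
  L2_inner (\sum_(i <- r) F i) y = \sum_(i <- r) L2_inner (F i) y.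
Proof.
elim: r => [|i r ih]; last by rewrite !big_cons L2_innerDl ih.
by rewrite !big_nil -(scale0r (0 : L2)) L2_innerZl mul0r.
Qed.

Definition coefficient (a b : L2) (A : trace_class mu) : R[i] := L2_inner (A a) b.

Variables a b : L2.
Local Notation ell := (coefficient a b).

Lemma coefficientD A B : ell (A + B) = ell A + ell B.
Proof. exact: L2_innerDl. Qed.

Lemma coefficientZ c A : ell (c *: A) = c * ell A.
Proof. exact: L2_innerZl. Qed.

Lemma coefficientB A B : ell (A - B) = ell A - ell B.
Proof. by rewrite coefficientD -scaleN1r coefficientZ mulN1r. Qed.

Lemma coefficient_sum I (r : seq I) (F : I -> trace_class mu) :
  ell (\sum_(i <- r) F i) = \sum_(i <- r) ell (F i).
Proof.
elim: r => [|i r ih]; last by rewrite !big_cons coefficientD ih.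
by rewrite !big_nil -(scale0r (0 : trace_class mu)) coefficientZ mul0r.
Qed.

Lemma coefficient_tensor x y : ell (tensor x y) = L2_inner a y * L2_inner x b.
Proof. exact: L2_innerZl. Qed.

(** Strong convergence of the series of rank one operators implies weak
    convergence. *)
Lemma coefficient_nuclear (A : trace_class mu) xi eta : nuclear_series A xi eta ->
  ccvg (fun n => \sum_(k < n) ell (tensor (xi k) (eta k))) (ell A).
Proof.
move=> [_ /(_ a) Aa]; apply: (@ccvg_bounded _ _ _ (fun n =>
  2 * L2_norm b * L2_norm (A a - \sum_(k < n) rank_one (xi k) (eta k) a))).
  move=> n; rewrite -normc_opp opprB -mulrA [L2_norm b * _]mulrC.
  apply: le_trans (L2_inner_le _ _); rewrite L2_innerBl L2_inner_suml.
  exact: lexx.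
by rewrite -[X in _ --> X](mulr0 (2 * L2_norm b)); apply: cvgMr.
Qed.

Definition nuclear_sum (xi eta : nat -> L2) : R :=
  limn (series (fun n => L2_norm (xi n) * L2_norm (eta n))).

Lemma series_nuclear_le (A : trace_class mu) xi eta n : nuclear_series A xi eta ->
  series (fun n => L2_norm (xi n) * L2_norm (eta n)) n <= nuclear_sum xi eta.
Proof.
move=> [cv _]; apply: nondecreasing_cvgn_le => //.
by apply: nondecreasing_series => k _; rewrite mulr_ge0 ?L2_norm_ge0.
Qed.

Lemma nuclear_sum_ge0 (A : trace_class mu) xi eta : nuclear_series A xi eta ->
  0 <= nuclear_sum xi eta.
Proof.
move=> nA; apply: le_trans (series_nuclear_le 0 nA).
by rewrite /series/= big_geq.
Qed.

Lemma trace_norm_le (A : trace_class mu) xi eta : nuclear_series A xi eta ->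
  trace_norm A <= nuclear_sum xi eta.
Proof.
move=> nA; apply: ge_inf; last by exists (xi, eta).
by exists 0 => _ [[u v] /= nuv <-]; exact: nuclear_sum_ge0 nuv.
Qed.

Lemma trace_norm_ge0 (A : trace_class mu) : 0 <= trace_norm A.
Proof.
have /asboolP [xi [eta nA]] := trace_classP A.
apply: lb_le_inf; first by exists (nuclear_sum xi eta); exists (xi, eta).
by move=> _ [[u v] /= nuv <-]; exact: nuclear_sum_ge0 nuv.
Qed.

(** Each tensor of a nuclear series contributes two inner products, and each
    of them is bounded with the constant 2; the infimum over all nuclear series is
    the trace norm. *)
Lemma coefficient_le (A : trace_class mu) :
  normc (ell A) <= 4 * (L2_norm a * L2_norm b) * trace_norm A.
Proof.
set c := 4 * (L2_norm a * L2_norm b).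
have c0 : 0 <= c by rewrite mulr_ge0 ?mulr_ge0 ?L2_norm_ge0.
have le_sum xi eta : nuclear_series A xi eta -> normc (ell A) <= c * nuclear_sum xi eta.
  move=> nA; have /ccvg_normP cvA := coefficient_nuclear nA.
  have cv : c * nuclear_sum xi eta - normc (ell A) +
      normc (\sum_(k < n) ell (tensor (xi k) (eta k)) - ell A) @[n --> \oo] -->
      c * nuclear_sum xi eta - normc (ell A).
    rewrite -[X in _ --> X]addr0; apply: cvgD => //; exact: cvg_cst.
  rewrite -subr_ge0 -(cvg_lim _ cv)//; apply: limr_ge; first exact: cvgP cv.
  apply: nearW => n; set s := \sum_(k < n) _.
  have : normc s <= c * nuclear_sum xi eta.
    apply: le_trans (normc_sum _ _ _) _.
    apply: (@le_trans _ _ (c * series (fun n => L2_norm (xi n) * L2_norm (eta n)) n)); last first.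
      by apply: ler_wpM2l => //; exact: series_nuclear_le nA.
    have -> : series (fun n => L2_norm (xi n) * L2_norm (eta n)) n =
        \sum_(k < n) L2_norm (xi k) * L2_norm (eta k) by rewrite /series/= big_mkord.
    rewrite mulr_sumr; apply: ler_sum => k _.
    rewrite coefficient_tensor Normc.normcM.
    apply: le_trans (ler_pM (normc_ge0 _) (normc_ge0 _) (L2_inner_le _ _) (L2_inner_le _ _)) _.
    by rewrite le_eqVlt; apply/orP; left; apply/eqP; rewrite /c; ring.
  have := normc_triangle (ell A - s) s; rewrite subrK -(normc_opp (ell A - s)) opprB.
  by lra.
(* dividing by c to reach the infimum requires c != 0 *)
have [c_eq0|cn0] := eqVneq c 0.
  have /asboolP [xi [eta nA]] := trace_classP A.
  by have := le_sum _ _ nA; rewrite c_eq0 !mul0r.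
have cp : 0 < c by rewrite lt_neqAle eq_sym cn0.
rewrite mulrC -ler_pdivrMr//; apply: lb_le_inf.
  have /asboolP [xi [eta nA]] := trace_classP A.
  by exists (nuclear_sum xi eta); exists (xi, eta).
by move=> _ [[u v] /= nuv <-]; rewrite ler_pdivrMr// mulrC; exact: le_sum.
Qed.

(** Removing the first terms of a nuclear series leaves an operator that the
    remaining terms represent, so its norm is at most the tail of the sum. *)
Lemma nuclear_tail (A : trace_class mu) xi eta : nuclear_series A xi eta ->
  trace_norm (A - \sum_(k < n) tensor (xi k) (eta k)) @[n --> \oo] --> (0 : R).
Proof.
move=> nA; have [cv Aa] := nA; pose s := series (fun n => L2_norm (xi n) * L2_norm (eta n)).
have sum_op (n : nat) (x : L2) : (\sum_(k < n) tensor (xi k) (eta k) : trace_class mu) x =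
    \sum_(k < n) rank_one (xi k) (eta k) x.
  elim: n => [|n ih]; first by rewrite !big_ord0.
  by rewrite !big_ord_recr /= -ih.
apply: (@cvg0_le _ _ (fun n => nuclear_sum xi eta - s n)) => [n|]; last first.
  rewrite -[X in _ --> X](subrr (nuclear_sum xi eta)); apply: cvgB; first exact: cvg_cst.
  exact: cv.
rewrite trace_norm_ge0/=.
have shift m : series (fun k => L2_norm (xi (k + n)%N) * L2_norm (eta (k + n)%N)) m =
    s (m + n)%N - s n.
  rewrite /s /series/= [X in X - _](@big_cat_nat _ _ _ n)//= ?leq_addl//.
  rewrite addrAC subrr add0r.
  have := @big_addn _ 0 +%R 0 (m + n)%N n xpredT
    (fun k => L2_norm (xi k) * L2_norm (eta k)).
  by rewrite add0n addnK => ->.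
have sh : s (m + n)%N - s n @[m --> \oo] --> nuclear_sum xi eta - s n.
  by apply: cvgB; [rewrite cvg_shiftn|exact: cvg_cst].
have nt : nuclear_series (A - \sum_(k < n) tensor (xi k) (eta k))
    (fun k => xi (k + n)%N) (fun k => eta (k + n)%N).
  split.
    by rewrite (funext shift); exact: cvgP sh.
  move=> x; rewrite (_ : (fun m => _) = (fun m => L2_norm (A x -
      \sum_(k < (m + n)%N) rank_one (xi k) (eta k) x))).
    by rewrite (cvg_shiftn n (fun m => L2_norm (A x - \sum_(k < m) rank_one (xi k) (eta k) x))); exact: Aa.
  apply/funext => m; congr L2_norm.
  rewrite -[(A - _ : trace_class mu) x]/(A x - (\sum_(k < n) tensor (xi k) (eta k) : trace_class mu) x).
  rewrite sum_op -addrA -opprD; congr (_ - _).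
  by rewrite addnC big_split_ord/=; congr (_ + _); apply: eq_bigr => k _; rewrite addnC.
apply: le_trans (trace_norm_le nt) _.
by rewrite /nuclear_sum (funext shift) (cvg_lim _ sh).
Qed.

End L2Theory.

(** * Dual convolution of elementary tensors *)

Section LowerIntegral.
Context d (T : measurableType d) (R : realType) (mu : {measure set T -> \bar R}).

Import HBNNSimple.

(** The integral of a nonnegative function is a supremum over the simple
    functions below it, hence monotone without any measurability of the larger
    function.  This matters for the trace norm of a vector-valued integrand,
    which is not known to be measurable. *)
Lemma le_integral_nonmeasurable (f g : T -> \bar R) :
  (forall x, 0 <= f x)%E -> (forall x, f x <= g x)%E ->
  (\int[mu]_x f x <= \int[mu]_x g x)%E.
Proof.
move=> f0 fg; rewrite !ge0_integralTE//; last first.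
  by move=> x; exact: le_trans (fg x).
apply: le_ereal_sup => _ [h hf <-]; exists h => // x.
exact: le_trans (hf x) (fg x).
Qed.

Lemma ae_le_integral_nonmeasurable (f g : T -> R) (c : R) : 0 < c ->
  measurable_fun setT f -> (forall x, 0 <= f x) -> (forall x, 0 <= g x) ->
  {ae mu, forall x, f x <= c * g x} ->
  (\int[mu]_x (f x)%:E <= c%:E * \int[mu]_x (g x)%:E)%E.
Proof.
move=> c0 mf f0 g0 [Z [mZ Z0 fgZ]].
pose h x := f x * \1_(~` Z) x / c.
have mI : measurable_fun setT (\1_(~` Z) : T -> R).
  by apply: measurable_indic; exact: measurableC.
have mh : measurable_fun setT h.
  by apply: measurable_funM => //; exact: measurable_funM.
have h0 x : 0 <= h x by rewrite !mulr_ge0 ?invr_ge0// ltW.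
have hg x : h x <= g x.
  rewrite /h indicE; case: (boolP (x \in ~` Z)) => xZ; last by rewrite mulr0 mul0r.
  rewrite mulr1 ler_pdivrMr// mulrC; apply: contrapT => fg.
  by move: xZ; rewrite inE => xZ; apply: xZ; exact: fgZ.
apply: (@le_trans _ _ (c%:E * \int[mu]_x (h x)%:E)%E); last first.
  apply: lee_wpmul2l; first by rewrite lee_fin ltW.
  by apply: le_integral_nonmeasurable => x; rewrite lee_fin.
rewrite -ge0_integralZl//; last 3 first.
- exact/measurable_EFinP.
- by move=> x _; rewrite lee_fin.
- by rewrite lee_fin ltW.
rewrite le_eqVlt; apply/orP; left; apply/eqP; apply: ge0_ae_eq_integral => //.
- exact/measurable_EFinP.
- by apply: emeasurable_funM => //; exact/measurable_EFinP.
- by move=> x _; rewrite lee_fin.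
- by move=> x _; rewrite mule_ge0// lee_fin// ltW.
exists Z; split => // x /= nfx; apply: contrapT => xZ; apply: nfx => _.
rewrite -EFinM /h indicE mem_set// mulr1 mulrCA mulfV ?mulr1//.
by rewrite gt_eqF.
Qed.

End LowerIntegral.

Section RankOne.
Variable R : realType.
Local Notation RR := (measurableTypeR R).
Local Notation mu := (haar R).
Local Notation nu := (haar2 R).
Implicit Types x y a b : L2Rx R.

Lemma translation_ae (r : R) x : r != 0 ->
  {ae mu, forall t, translation r x t = x (r^-1 * t)}.
Proof.
move=> r0; apply: L2_of_ae; have rV0 : r^-1 != 0 by rewrite invr_eq0.
split.
  exact: cmeasurable_comp (haar_scale rV0).1 (cmeasurable_L2 x).
have := haar_scale_integral rV0 (f := fun t => (normc (x t) ^+ 2)%:E) => ->.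
- exact: L2_fin.
- by apply/measurable_EFinP/measurable_normc2; exact: cmeasurable_L2.
- by move=> t; rewrite lee_fin sqr_ge0.
Qed.

(** The function that dual_product h represents for almost every h. *)
Definition dual_factor (x x' : RR -> R[i]) (h s : RR) : R[i] :=
  x (s / (1 + h)) * x' (h * s / (1 + h)).

Lemma cmeasurable_dual_factor (x x' : RR -> R[i]) : cmeasurable x ->
  cmeasurable x' -> cmeasurable (fun p : RR * RR => dual_factor x x' p.1 p.2).
Proof.
move=> mx mx'; apply: cmeasurableM.
  exact: (cmeasurable_comp (@measurable_dilate R) mx).
exact: (cmeasurable_comp (@measurable_codilate R) mx').
Qed.

Lemma dual_factor_square_integrable x x' :
  {ae mu, forall h : RR, square_integrable mu (dual_factor x x' h)}.
Proof.
have mD : cmeasurable (fun p : RR * RR => dual_factor x x' p.1 p.2).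
  by apply: cmeasurable_dual_factor; exact: cmeasurable_L2.
have mD2 : measurable_fun setT
    (fun p : RR * RR => (normc (dual_factor x x' p.1 p.2) ^+ 2)%:E).
  by apply/measurable_EFinP; exact: measurable_normc2.
have m2 (z : L2Rx R) : measurable_fun setT (fun t => (normc (z t) ^+ 2)%:E).
  by apply/measurable_EFinP/measurable_normc2; exact: cmeasurable_L2.
have p2 (z : L2Rx R) t : (0 <= (normc (z t) ^+ 2)%:E)%E by rewrite lee_fin sqr_ge0.
have E := integral_dilate_codilate (m2 x) (m2 x') (p2 x) (p2 x').
have fin : mu.-integrable setT
    (fun h => \int[mu]_s (normc (dual_factor x x' h s) ^+ 2)%:E)%E.
  apply/integrableP; split.
    by apply: (measurable_fun_fubini_tonelli_F (m2 := mu) _ mD2) => p; rewrite lee_fin sqr_ge0.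
  under eq_integral => h _.
    rewrite gee0_abs; last by apply: integral_ge0 => s _; rewrite lee_fin sqr_ge0.
    under eq_integral do rewrite Normc.normcM exprMn EFinM.
    over.
  rewrite E -!L2_norm_sqr -EFinM; exact: ltry.
apply: filterS (integrable_ae measurableT fin) => h /(_ I) hfin; split.
  exact: (cmeasurable_section h mD).
by rewrite -ge0_fin_numE//; apply: integral_ge0 => s _; rewrite lee_fin sqr_ge0.
Qed.

(** The class of a function that fails to be square integrable is 0, so the
    dual product is the expected function only for those h at which it is square
    integrable; by Tonelli these are almost all h. *)
Lemma dual_product_ae x x' : {ae mu, forall h : RR,
  {ae mu, forall s, dual_product h x x' s = dual_factor x x' h s}}.
Proof.
apply: filterS3 (haar_ae_neq (0 : R)) (haar_ae_neq (-1 : R))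
  (dual_factor_square_integrable x x') => h h0 h1 sq.
have h1' := neq0_onep h1.
have hV : 1 + h^-1 != 0.
  by rewrite (_ : 1 + h^-1 = (1 + h) / h) ?mulf_neq0 ?invr_eq0//; field.
have tE : {ae mu, forall s, translation (1 + h) x s * translation (1 + h^-1) x' s =
    dual_factor x x' h s}.
  apply: filterS2 (translation_ae x h1') (translation_ae x' hV) => s -> ->.
  have -> : (1 + h)^-1 * s = s / (1 + h) by rewrite mulrC.
  have -> : (1 + h^-1)^-1 * s = h * s / (1 + h) by field; rewrite h0 h1'.
  by [].
have mT : cmeasurable (fun s => translation (1 + h) x s * translation (1 + h^-1) x' s).
  by apply: cmeasurableM; exact: cmeasurable_L2.
have sT : square_integrable mu
    (fun s => translation (1 + h) x s * translation (1 + h^-1) x' s).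
  split => //; case: sq => mq; apply: le_lt_trans.
  rewrite le_eqVlt; apply/orP; left; apply/eqP; apply: ge0_ae_eq_integral => //.
  - by apply/measurable_EFinP; exact: measurable_normc2.
  - by apply/measurable_EFinP; exact: measurable_normc2.
  - by move=> s _; rewrite lee_fin sqr_ge0.
  - by move=> s _; rewrite lee_fin sqr_ge0.
  - by apply: filterS tE => s ->.
by apply: filterS2 (L2_of_ae sT) tE => s -> ->.
Qed.

Lemma cintegrable_paired_twist x y x' y' a b :
  cintegrable (mu \x nu)%E (paired_twist b a (kernel2 x y) (kernel2 x' y')).
Proof.
split; last exact: le_lt_trans (paired_twist_estimate _ _ _ _ _ _) (ltry _).
by apply: cmeasurable_paired_twist;
  do ?[exact: cmeasurable_L2|apply: cmeasurable_kernel2].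
Qed.

Lemma coefficient_tensor_ae (u v a b : L2Rx R) (U V : RR -> R[i]) :
  cmeasurable U -> cmeasurable V ->
  {ae mu, forall s, u s = U s} -> {ae mu, forall t, v t = V t} ->
  coefficient a b (tensor u v) = cintegral nu (pairing b a (kernel2 U V)).
Proof.
move=> mU mV uU vV; rewrite coefficient_tensor mulrC /L2_inner.
have i1 := cintegrable_innerL2 u b; have i2 := cintegrable_innerL2 a v.
rewrite -(haar2_cintegral_tensor i1 i2).
have iT := haar2_cintegrable_tensor i1 i2.
apply: ae_eq_cintegral; first exact: cmeasurable_integrable iT.
  by apply: cmeasurable_pairing;
    do ?[exact: cmeasurable_L2|apply: cmeasurable_kernel2].
apply: filterS2 (haar2_ae_fst uU) (haar2_ae_snd vV) => p -> ->.
by rewrite /pairing /kernel2; ring.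
Qed.

Lemma pairing_dual_factor (x x' y y' b a : RR -> R[i]) h p :
  pairing b a (kernel2 (dual_factor x x' h) (dual_factor y y' h)) p =
  paired_twist b a (kernel2 x y) (kernel2 x' y') (h, p).
Proof.
rewrite /paired_twist /pairing /twist /kernel2 /dual_factor/= !rmorphM/=; ring.
Qed.

Lemma coefficient_dual_product x y x' y' a b : {ae mu, forall h : RR,
  coefficient a b (tensor (dual_product h x x') (dual_product h y y')) =
  cintegral nu (fun p => paired_twist b a (kernel2 x y) (kernel2 x' y') (h, p))}.
Proof.
apply: filterS2 (dual_product_ae x x') (dual_product_ae y y') => h fx fy.
rewrite (coefficient_tensor_ae a b _ _ fx fy).
- by congr cintegral; apply/funext => p; exact: pairing_dual_factor.
- by apply: (cmeasurable_section h (cmeasurable_dual_factor (cmeasurable_L2 x) (cmeasurable_L2 x'))).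
- by apply: (cmeasurable_section h (cmeasurable_dual_factor (cmeasurable_L2 y) (cmeasurable_L2 y'))).
Qed.

(** The coefficient of a step function is a finite combination of indicators,
    for which the integral is computed term by term. *)
Lemma step_coefficient a b (s : seq (set RR * S1 R)) : step_function mu s ->
  cintegrable mu (fun h => coefficient a b (step_value s h)) /\
  cintegral mu (fun h => coefficient a b (step_value s h)) =
  coefficient a b (step_integral mu s).
Proof.
rewrite /step_value /step_integral; elim: s => [_|p s ih sp].
  under eq_fun do rewrite big_nil; rewrite big_nil.
  have c0 : coefficient a b 0 = 0.
    by rewrite -(scale0r (0 : S1 R)) coefficientZ mul0r.
  by rewrite c0; split; [exact: cintegrable0|exact: cintegral0].
have [i1 E1] : cintegrable mu (fun h => coefficient a b (step_value s h)) /\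
  cintegral mu (fun h => coefficient a b (step_value s h)) =
  coefficient a b (step_integral mu s).
  by apply: ih => q qs; apply: sp; rewrite inE qs orbT.
have [mp pfin] : measurable p.1 /\ (mu p.1 < +oo)%E by apply: sp; rewrite inE eqxx.
have mI : measurable_fun setT (\1_(p.1) : RR -> R) by exact: measurable_indic.
have iI : cintegrable mu (fun h => (\1_(p.1) h)%:C).
  split; first exact: cmeasurable_real.
  under eq_integral do rewrite normc_real ger0_norm//.
  by rewrite integral_indic// setIT.
have EI : cintegral mu (fun h => (\1_(p.1) h)%:C) = (fine (mu p.1))%:C.
  apply: complex_ext => /=; last by rewrite Rintegral_cst// mul0r.
  by rewrite /Rintegral integral_indic// setIT.
have iP : cintegrable mu (fun h => coefficient a b p.2 * (\1_(p.1) h)%:C).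
  exact: cintegrableZ.
under eq_fun do rewrite big_cons coefficientD coefficientZ mulrC.
rewrite big_cons coefficientD coefficientZ mulrC -EI -cintegralZ//.
split; first exact: cintegrableD.
by rewrite cintegralD// E1.
Qed.

(** Coefficients are bounded functionals, so they can be moved inside the
    Bochner integral that defines the dual convolution of elementary tensors. *)
Lemma coefficient_box_tensor (box : {bilinear S1 R -> S1 R -> S1 R})
    (hbox : dual_convolution box) x y x' y' a b :
  coefficient a b (box (tensor x y) (tensor x' y')) =
  cintegral (mu \x nu)%E (paired_twist b a (kernel2 x y) (kernel2 x' y')).
Proof.
have [s [step _ cvI cvN]] := hbox.2 x y x' y'.
pose F h := tensor (dual_product h x x') (dual_product h y y').
set v := box _ _ in cvN *; set q := paired_twist _ _ _ _.
have [_ ml il ->] := cintegral_fubini (cintegrable_paired_twist x y x' y' a b).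
pose l h := cintegral nu (fun p => q (h, p)).
rewrite -/(l) in ml il *.
(* the summand 1 makes the constant positive even if a or b vanishes *)
pose c := 4 * (L2_norm a * L2_norm b) + 1.
have c0 : 0 < c by rewrite ltr_wpDl// !mulr_ge0 ?L2_norm_ge0.
have coef_le A : normc (coefficient a b A) <= c * trace_norm A.
  apply: le_trans (coefficient_le _ _ _) _; apply: ler_wpM2r.
    exact: trace_norm_ge0.
  by rewrite /c lerDl.
pose I n := (\int[mu]_h (trace_norm (F h - step_value (s n) h))%:E)%E.
have I0 n : (0 <= I n)%E.
  by apply: integral_ge0 => h _; rewrite lee_fin trace_norm_ge0.
apply: (@ccvg_unique _ (fun n => coefficient a b (step_integral mu (s n)))).
  apply: (@ccvg_bounded _ _ _ (fun n => c * trace_norm (v - step_integral mu (s n)))).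
    by move=> n; rewrite -normc_opp opprB -coefficientB.
  by rewrite -[X in _ --> X](mulr0 c); apply: cvgMr.
have fI : fine (I n) @[n --> \oo] --> (0 : R) by exact: (fine_cvg cvI).
apply/ccvg_normP.
have key n : ((normc (coefficient a b (step_integral mu (s n)) - cintegral mu l))%:E <=
    2%:E * (c%:E * I n))%E.
  have [i1 <-] := step_coefficient a b (step n).
  rewrite -cintegralB//.
  apply: (le_trans (cintegral_norm_le (cintegrableB i1 il))).
  apply: lee_wpmul2l => //; apply: ae_le_integral_nonmeasurable => //.
  - by apply: measurable_normc; case: (cintegrableB i1 il).
  - by move=> h; exact: normc_ge0.
  - by move=> h; exact: trace_norm_ge0.
  - apply: filterS (coefficient_dual_product x y x' y' a b) => h hE.
    by rewrite -[l h]hE -normc_opp opprB -coefficientB.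
have finI : \forall n \near \oo, I n \is a fin_num.
  have [+ _] := (fine_cvgP _ _).1 cvI; exact.
have cvc : 2 * (c * fine (I n)) @[n --> \oo] --> (0 : R).
  rewrite -[X in _ --> X](mulr0 2); apply: cvgMr.
  by rewrite -[X in _ --> X](mulr0 c); exact: cvgMr.
apply: (@squeeze_cvgr _ _ _ _ (cst 0) (fun n => 2 * (c * fine (I n)))).
- apply: filterS finI => n nfin; rewrite normc_ge0/= -lee_fin.
  by apply: le_trans (key n) _; rewrite !EFinM fineK.
- exact: cvg_cst.
- exact: cvc.
Qed.

End RankOne.

(** * Kernels are determined by their matrix coefficients *)

Section RectangleUniqueness.
Context d1 d2 (T1 : measurableType d1) (T2 : measurableType d2) (R : realType).
Variable m : {measure set (T1 * T2) -> \bar R}.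

(** The sets on which h integrates to 0 form a Dynkin system that contains the
    rectangles, hence all measurable sets. *)
Lemma rectangle_ae0_real (h : T1 * T2 -> R) :
  m.-integrable setT (fun p => (h p)%:E) ->
  (forall A B, measurable A -> measurable B -> (\int[m]_(p in A `*` B) (h p)%:E = 0)%E) ->
  {ae m, forall p, h p = 0}.
Proof.
move=> ih rect.
pose G : set (set (T1 * T2)) :=
  [set C | exists A, measurable A /\ exists B, measurable B /\ C = A `*` B].
pose P : set (set (T1 * T2)) := [set E | (\int[m]_(p in E) (h p)%:E = 0)%E].
have GE : @measurable _ (T1 * T2)%type = <<s G >>.
  rewrite measurable_prod_measurableType //; congr (<<s _ >>).
  rewrite predeqE => E; split => [[A mA [B mB <-]]|[A [mA [B [mB ->]]]]].
    by exists A; split => //; exists B.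
  by exists A => //; exists B.
have GI : setI_closed G.
  move=> /= _ _ [X1 [mX1 [X2 [mX2 ->]]]] [Y1 [mY1 [Y2 [mY2 ->]]]].
  rewrite -setXI; exists (X1 `&` Y1); split; first exact: measurableI.
  by exists (X2 `&` Y2); split => //; exact: measurableI.
have PT : P setT by rewrite /P/= -setXTT; exact: rect.
have PE E : measurable E -> P E.
  rewrite GE; apply: (dynkin_induction GE GI PT) => {E}.
  - by move=> _ [A [mA [B [mB ->]]]]; exact: rect.
  - move=> S mS PS; rewrite /P/=; have := PT.
    rewrite /P/= -(setUv S) integral_setU//.
    + by rewrite [X in (X + _)%E](_ : _ = 0%E) ?add0e.
    + exact: measurableC.
    + by rewrite setUv; exact: measurable_int ih.
    + by rewrite disj_set2E setICr.
  - move=> F mF tF PF; rewrite /P/= integral_bigcup//.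
      by apply: eseries0 => i _ _; exact: PF.
    by apply: (integrableS measurableT _ _ ih) => //; exact: bigcupT_measurable.
have := integral_ae_eq measurableT ih (measurable_cst 0%E).
have E0 E : E `<=` setT -> measurable E ->
    (\int[m]_(x in E) (h x)%:E = \int[m]_(x in E) cst 0 x)%E.
  by move=> _ mE; rewrite (PE _ mE) integral0.
by move=> /(_ E0); apply: filterS => p /(_ I) /= [].
Qed.

Lemma rectangle_ae0 (f : T1 * T2 -> R[i]) : cintegrable m f ->
  (forall A B, measurable A -> measurable B ->
     cintegral m (fun p => (\1_A p.1 * \1_B p.2)%:C * f p) = 0) ->
  {ae m, forall p, f p = 0}.
Proof.
move=> /[dup] -[mf _] /cintegrableP[f1 f2] rect.
have aux (h : T1 * T2 -> R) : m.-integrable setT (fun p => (h p)%:E) ->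
    (forall A B, measurable A -> measurable B ->
      \int[m]_p (\1_A p.1 * \1_B p.2 * h p) = 0) -> {ae m, forall p, h p = 0}.
  move=> ih hrect; apply: rectangle_ae0_real => // A B mA mB.
  have mAB : measurable (A `*` B) by exact: measurableX.
  have iAB : m.-integrable (A `*` B) (fun p => (h p)%:E) by exact: integrableS ih.
  rewrite -[LHS]fineK; last exact: integrable_fin_num.
  congr (_%:E); rewrite -(hrect A B mA mB) /Rintegral; congr fine.
  rewrite [LHS]integral_mkcond; apply: eq_integral => p _.
  rewrite patchE !indicE; case: ifPn => [|] pAB.
    by move: pAB; rewrite inE => -[pA pB]; rewrite !mem_set// !mul1r.
  have [pA|pA] := boolP (p.1 \in A); last by rewrite !mul0r.
  have [pB|pB] := boolP (p.2 \in B); last by rewrite mulr0 mul0r.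
  by exfalso; move: pAB; rewrite notin_setE; apply; split; exact: set_mem.
have h1 : {ae m, forall p, complex.Re (f p) = 0}.
  apply: aux => // A B mA mB; have /(congr1 (@complex.Re R)) /= <- := rect A B mA mB.
  by apply: eq_Rintegral => p _; rewrite cReM/= mul0r subr0.
have h2 : {ae m, forall p, complex.Im (f p) = 0}.
  apply: aux => // A B mA mB; have /(congr1 (@complex.Im R)) /= <- := rect A B mA mB.
  by apply: eq_Rintegral => p _; rewrite cImM/= mul0r addr0.
by apply: filterS2 h1 h2 => p p1 p2; exact: complex_ext.
Qed.

End RectangleUniqueness.

Lemma conj_real_complex (R : realType) (r : R) : Num.conj (r%:C : R[i]) = r%:C.
Proof. by apply: complex_ext => //=; rewrite oppr0. Qed.

Lemma real_factors (R : realType) (u v w z : R) (k : R[i]) :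
  (u * v)%:C * k * (w * z)%:C = (u * w)%:C * ((v * z)%:C * k).
Proof. by rewrite !rmorphM; ring. Qed.

Section KernelUniqueness.
Variable R : realType.
Local Notation RR := (measurableTypeR R).
Local Notation mu := (haar R).
Local Notation nu := (haar2 R).
Implicit Types x y a b : L2Rx R.
Implicit Types K : RR * RR -> R[i].

(** A square integrable function without zeros off the origin, used to turn
    arbitrary measurable sets into square integrable test functions. *)
Definition weight (t : RR) : R := gauss t `^ 2^-1.

Lemma weight_gt0 t : t != 0 -> 0 < weight t.
Proof. by move=> t0; rewrite powR_gt0// gauss_gt0. Qed.

Lemma measurable_weight : measurable_fun setT weight.
Proof. exact: (measurableT_comp (measurable_powR _) (@measurable_gauss R)). Qed.

Lemma weight_sqr t : weight t ^+ 2 = gauss t.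
Proof. by rewrite /weight powR12_sqrt ?gauss_ge0// sqr_sqrtr ?gauss_ge0. Qed.

Definition weighted_set (A : set RR) : L2Rx R :=
  L2_of mu (fun t => (\1_A t * weight t)%:C).

Lemma weighted_set_ae A : measurable A ->
  {ae mu, forall t, weighted_set A t = (\1_A t * weight t)%:C}.
Proof.
move=> mA; apply: L2_of_ae; have mI : measurable_fun setT (\1_A : RR -> R) by exact: measurable_indic.
have mw : measurable_fun setT (fun t => \1_A t * weight t).
  by apply: measurable_funM => //; exact: measurable_weight.
split; first exact: cmeasurable_real.
apply: (@le_lt_trans _ _ (\int[mu]_t (gauss t)%:E)%E); last by rewrite integral_gauss ltry.
apply: ge0_le_integral => //.
- by move=> t _; rewrite lee_fin sqr_ge0.
- by apply/measurable_EFinP/measurable_normc2/cmeasurable_real.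
- by apply/measurable_EFinP; exact: measurable_gauss.
- move=> t _; rewrite lee_fin normc_real real_normK ?num_real// exprMn weight_sqr.
  rewrite indicE; case: (_ \in _); rewrite ?expr1n ?mul1r// expr0n mul0r.
  exact: gauss_ge0.
Qed.

Lemma pairing_ae (b a : RR -> R[i]) (fb fa : RR -> R[i]) K :
  {ae mu, forall t, b t = fb t} -> {ae mu, forall t, a t = fa t} ->
  {ae nu, forall p, pairing b a K p = pairing fb fa K p}.
Proof.
move=> bE aE; apply: filterS2 (haar2_ae_fst bE) (haar2_ae_snd aE) => p E1 E2.
by rewrite /pairing E1 E2.
Qed.

Lemma pairing_weighted_ae A B K : measurable A -> measurable B ->
  {ae nu, forall p, pairing (weighted_set A) (weighted_set B) K p =
    (\1_A p.1 * \1_B p.2)%:C * ((weight p.1 * weight p.2)%:C * K p)}.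
Proof.
move=> mA mB.
apply: filterS (pairing_ae K (weighted_set_ae mA) (weighted_set_ae mB)) => p ->.
by rewrite /pairing; cbv beta; rewrite conj_real_complex; exact: real_factors.
Qed.

Lemma ae_weight : {ae nu, forall p : RR * RR, (weight p.1 * weight p.2)%:C != 0}.
Proof.
apply: filterS2 (haar2_ae_fst (haar_ae_neq (0 : R))) (haar2_ae_snd (haar_ae_neq (0 : R))) => p p1 p2.
by rewrite fmorph_eq0 mulf_neq0// gt_eqF// weight_gt0.
Qed.

(** Coefficients against indicators, weighted to be square integrable, are the
    integrals over rectangles of a fixed positive multiple of the kernel. *)
Lemma kernel_unique K K' : cmeasurable K -> cmeasurable K' ->
  (forall a b, cintegrable nu (pairing b a K)) ->
  (forall a b, cintegrable nu (pairing b a K')) ->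
  (forall a b, cintegral nu (pairing b a K) = cintegral nu (pairing b a K')) ->
  {ae nu, forall p, K p = K' p}.
Proof.
move=> mK mK' iK iK' E.
have mW : cmeasurable (fun p : RR * RR => (weight p.1 * weight p.2)%:C).
  apply: cmeasurable_real; apply: measurable_funM.
    exact: (measurableT_comp measurable_weight measurable_fst).
  exact: (measurableT_comp measurable_weight measurable_snd).
have mI A B : measurable A -> measurable B ->
    cmeasurable (fun p : RR * RR => (\1_A p.1 * \1_B p.2)%:C).
  move=> mA mB; have mA' : measurable_fun setT (\1_A : RR -> R) by exact: measurable_indic.
  have mB' : measurable_fun setT (\1_B : RR -> R) by exact: measurable_indic.
  apply: cmeasurable_real; apply: measurable_funM.
    have mf : measurable_fun setT (fst : RR * RR -> RR) by exact: measurable_fst.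
    apply: (measurableT_comp _ mf); exact: measurable_indic.
  have mf : measurable_fun setT (snd : RR * RR -> RR) by exact: measurable_snd.
  apply: (measurableT_comp _ mf); exact: measurable_indic.
have mIW A B K0 : measurable A -> measurable B -> cmeasurable K0 -> cmeasurable (fun p : RR * RR =>
    (\1_A p.1 * \1_B p.2)%:C * ((weight p.1 * weight p.2)%:C * K0 p)).
  by move=> mA mB mK0; apply: cmeasurableM; [exact: mI|exact: cmeasurableM].
have iIW A B K0 : measurable A -> measurable B -> cmeasurable K0 ->
    (forall a b, cintegrable nu (pairing b a K0)) ->
    cintegrable nu (fun p : RR * RR =>
     (\1_A p.1 * \1_B p.2)%:C * ((weight p.1 * weight p.2)%:C * K0 p)).
  move=> mA mB mK0 iK0; apply: ae_cintegrable (iK0 (weighted_set B) (weighted_set A)).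
    exact: mIW.
  exact: pairing_weighted_ae.
have D0 : {ae nu, forall p, (weight p.1 * weight p.2)%:C * K p -
    (weight p.1 * weight p.2)%:C * K' p = 0}.
  apply: rectangle_ae0.
    have E1 K0 : (fun p : RR * RR => (weight p.1 * weight p.2)%:C * K0 p) =
      (fun p : RR * RR =>
        (\1_[set: RR] p.1 * \1_[set: RR] p.2)%:C * ((weight p.1 * weight p.2)%:C * K0 p)).
      by apply/funext => p; rewrite !indicT mulr1 mul1r.
    by apply: cintegrableB; rewrite E1; exact: iIW.
  move=> A B mA mB; under eq_fun do rewrite mulrBr.
  rewrite cintegralB; [|exact: iIW..].
  have EW K0 : cmeasurable K0 -> (forall a b, cintegrable nu (pairing b a K0)) ->
      cintegral nu (fun p : RR * RR =>
     (\1_A p.1 * \1_B p.2)%:C * ((weight p.1 * weight p.2)%:C * K0 p)) =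
      cintegral nu (pairing (weighted_set A) (weighted_set B) K0).
    move=> mK0 iK0; apply/esym/ae_eq_cintegral.
    - exact: cmeasurable_integrable (iK0 _ _).
    - exact: mIW.
    - exact: pairing_weighted_ae.
  by rewrite !EW// E subrr.
apply: filterS2 D0 ae_weight => p /eqP + wp.
by rewrite -mulrBr mulf_eq0 (negbTE wp)/= subr_eq0 => /eqP.
Qed.

Lemma cintegrable_pairing a b K : square_integrable nu K ->
  cintegrable nu (pairing b a K).
Proof.
move=> [mK Ko].
have mp : cmeasurable (pairing b a K).
  by apply: cmeasurable_pairing => //; exact: cmeasurable_L2.
have ma : measurable_fun setT (fun t => normc (a t)) by exact/measurable_normc/cmeasurable_L2.
have mb : measurable_fun setT (fun t => normc (b t)) by exact/measurable_normc/cmeasurable_L2.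
have mab : measurable_fun setT (fun p : RR * RR => normc (b p.1) * normc (a p.2)).
  apply: measurable_funM.
    exact: (measurableT_comp mb measurable_fst).
  exact: (measurableT_comp ma measurable_snd).
have I0 : (0 <= \int[nu]_p (normc (K p) ^+ 2)%:E)%E.
  by apply: integral_ge0 => p _; rewrite lee_fin sqr_ge0.
apply: (@cintegrable_le _ _ _ _ _ (fun p => (normc (b p.1) * normc (a p.2)) * normc (K p))) => //.
- by apply: measurable_funM => //; exact: measurable_normc.
- by move=> p; rewrite /pairing !Normc.normcM normc_conj mulrAC.
apply: (@le_lt_trans _ _ ((L2_norm b * L2_norm a) *
    Num.sqrt (fine (\int[nu]_p (normc (K p) ^+ 2)%:E)))%:E); last exact: ltry.
apply: cauchy_schwarz_ge0 => //.
- exact: measurable_normc.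
- by move=> p; rewrite mulr_ge0// normc_ge0.
- by move=> p; exact: normc_ge0.
- by rewrite mulr_ge0 ?L2_norm_ge0.
- under eq_integral do rewrite exprMn EFinM.
  rewrite exprMn EFinM !L2_norm_sqr.
  rewrite (haar2_integral_tensor (u := fun t => (normc (b t) ^+ 2)%:E)
    (v := fun t => (normc (a t) ^+ 2)%:E))//.
  + by apply/measurable_EFinP; exact: measurable_funX.
  + by apply/measurable_EFinP; exact: measurable_funX.
  + by move=> t; rewrite lee_fin sqr_ge0.
  + by move=> t; rewrite lee_fin sqr_ge0.
- rewrite sqr_sqrtr ?fine_ge0// fineK// ge0_fin_numE//.
Qed.

End KernelUniqueness.

(** * Pointwise convergence of nuclear series of kernels *)

Lemma ccvg_absolute (R : realType) (z : nat -> R[i]) (B : R) :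
  (forall n, \sum_(k < n) normc (z k) <= B) ->
  exists w, ccvg (fun n => \sum_(k < n) z k) w.
Proof.
move=> zB; have cn : cvgn (series (fun n => normc (z n))).
  apply: nondecreasing_is_cvgn.
    by apply: nondecreasing_series => *; exact: normc_ge0.
  by exists B => _ [n _ <-]; rewrite /series/= big_mkord.
have half (f : R[i] -> R) : (forall w, `|f w| <= normc w) ->
    cvgn (fun n => \sum_(k < n) f (z k)).
  move=> fn; have : cvgn (series (fun n => f (z n))).
    by apply: normed_cvg; apply: (series_le_cvg _ _ _ cn) => n;
      [exact: normr_ge0|exact: normc_ge0|exact: fn].
  by rewrite (_ : series _ = (fun n => \sum_(k < n) f (z k)))//;
    apply/funext => n; rewrite /series/= big_mkord.
exists (limn (fun n => \sum_(k < n) complex.Re (z k)) +i*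
  limn (fun n => \sum_(k < n) complex.Im (z k))).
split => /=.
  by under eq_fun do rewrite Re_sum; exact: half (@normr_Re_le R).
by under eq_fun do rewrite Im_sum; exact: half (@normr_Im_le R).
Qed.

(** Multiplication by the indicator of a measurable set of full measure on which
    the sequence converges makes it converge everywhere, which gives a measurable
    limit. *)
Lemma ae_limit d (T : measurableType d) (R : realType)
    (mu : {measure set T -> \bar R}) (f : nat -> T -> R[i]) :
  (forall n, cmeasurable (f n)) ->
  {ae mu, forall x, exists w, ccvg (f ^~ x) w} ->
  exists2 g, cmeasurable g & {ae mu, forall x, ccvg (f ^~ x) (g x)}.
Proof.
move=> mf [Z [mZ Z0 fZ]].
have good x : ~ Z x -> exists w, ccvg (f ^~ x) w.
  by move=> nZ; apply: contrapT => nx; apply: nZ; exact: fZ.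
have mI : measurable_fun setT (\1_(~` Z) : T -> R).
  by apply: measurable_indic; exact: measurableC.
pose h n x := (\1_(~` Z) x : R)%:C * f n x.
have mh n : cmeasurable (h n) by apply: cmeasurableM => //; exact: cmeasurable_real.
have cvh x : exists w, ccvg (h ^~ x) w.
  have [xZ|/[dup] xZ /good[w fw]] := pselect (Z x).
    exists 0; rewrite /h indicE memNset; last by apply.
    by under eq_fun do rewrite mul0r; exact: ccvg_cst.
  exists w; rewrite /h indicE mem_set//.
  by under eq_fun do rewrite mul1r.
have [g hg] := choice cvh.
exists g.
  split.
    by apply: (measurable_fun_cvg (fun n => (mh n).1)) => x _; case: (hg x).
  by apply: (measurable_fun_cvg (fun n => (mh n).2)) => x _; case: (hg x).
exists Z; split => // x /= nx; apply: contrapT => xZ; apply: nx.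
have := hg x; rewrite /h indicE mem_set//.
by under eq_fun do rewrite mul1r.
Qed.

Section KernelSeries.
Variable R : realType.
Local Notation RR := (measurableTypeR R).
Local Notation mu := (haar R).
Local Notation nu := (haar2 R).
Implicit Types x y a b : L2Rx R.

Lemma is_kernel_coefficient (A : S1 R) K a b : is_kernel A K ->
  coefficient a b A = cintegral nu (pairing b a K).
Proof. by move=> [_ /(_ a b)]. Qed.

Lemma is_kernel_square_integrable (A : S1 R) K : is_kernel A K ->
  square_integrable nu K.
Proof. by case. Qed.

Lemma pairing_sum (b a : RR -> R[i]) I (r : seq I) (k : I -> RR * RR -> R[i]) p :
  pairing b a (fun p => \sum_(i <- r) k i p) p = \sum_(i <- r) pairing b a (k i) p.
Proof. by rewrite /pairing mulr_sumr mulr_suml. Qed.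

Lemma normc_pairing (b a : RR -> R[i]) K p :
  normc (pairing b a K p) = normc (b p.1) * normc (K p) * normc (a p.2).
Proof. by rewrite /pairing !Normc.normcM normc_conj. Qed.

Lemma coefficient_tensorE x y a b :
  coefficient a b (tensor x y) = cintegral nu (pairing b a (kernel2 x y)).
Proof.
by apply: coefficient_tensor_ae; do ?[exact: cmeasurable_L2|exact: nearW].
Qed.

Lemma integral_pairing_kernel2 x y a b :
  (\int[nu]_p (normc (pairing b a (kernel2 x y) p))%:E <=
   (L2_norm x * L2_norm b * (L2_norm y * L2_norm a))%:E)%E.
Proof.
have mM (u v : L2Rx R) : measurable_fun setT (fun t => (normc (u t) * normc (v t))%:E).
  apply/measurable_EFinP; apply: measurable_funM; apply: measurable_normc;
    exact: cmeasurable_L2.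
have M0 (u v : L2Rx R) t : (0 <= (normc (u t) * normc (v t))%:E)%E.
  by rewrite lee_fin mulr_ge0// normc_ge0.
rewrite (eq_integral (fun p => (normc (x p.1) * normc (b p.1))%:E *
    (normc (y p.2) * normc (a p.2))%:E)%E); last first.
  move=> p _; rewrite -EFinM; congr EFin.
  rewrite /pairing /kernel2 !Normc.normcM !normc_conj.
  move: (normc (x p.1)) (normc (b p.1)) (normc (y p.2)) (normc (a p.2)) => ? ? ? ?.
  by ring.
rewrite (haar2_integral_tensor (mM x b) (mM y a))// EFinM.
by apply: lee_pmul; rewrite ?integral_normM_L2//; exact: integral_ge0.
Qed.

Definition kernel_sum (xi eta : nat -> L2Rx R) (n : nat) (p : RR * RR) : R[i] :=
  \sum_(k < n) kernel2 (xi k) (eta k) p.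

Definition kernel_abs_sum (xi eta : nat -> L2Rx R) (n : nat) (p : RR * RR) : R :=
  \sum_(k < n) normc (kernel2 (xi k) (eta k) p).

Lemma cmeasurable_kernel2_L2 x y : cmeasurable (kernel2 x y).
Proof. by apply: cmeasurable_kernel2; exact: cmeasurable_L2. Qed.

Lemma cmeasurable_kernel_sum xi eta n : cmeasurable (kernel_sum xi eta n).
Proof.
by apply: (@cmeasurable_sum _ _ _ _ _ (fun k : 'I_n => kernel2 (xi k) (eta k))) => k;
  exact: cmeasurable_kernel2_L2.
Qed.

Lemma measurable_kernel_abs_sum xi eta n :
  measurable_fun setT (kernel_abs_sum xi eta n).
Proof.
apply: measurable_sum => k; apply: measurable_normc.
exact: cmeasurable_kernel2_L2.
Qed.

Lemma kernel_abs_sum_ge0 xi eta n p : 0 <= kernel_abs_sum xi eta n p.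
Proof. by apply: sumr_ge0 => k _; exact: normc_ge0. Qed.

Lemma kernel_abs_sum_nd xi eta p : nondecreasing_seq (kernel_abs_sum xi eta ^~ p).
Proof.
apply/nondecreasing_seqP => n; rewrite /kernel_abs_sum big_ord_recr/= lerDl.
exact: normc_ge0.
Qed.

Lemma kernel_sum_le xi eta n p :
  normc (kernel_sum xi eta n p) <= kernel_abs_sum xi eta n p.
Proof. exact: normc_sum. Qed.

Lemma integral_pairing_abs_sum (A : S1 R) xi eta n a b : nuclear_series A xi eta ->
  (\int[nu]_p (normc (b p.1) * kernel_abs_sum xi eta n p * normc (a p.2))%:E <=
   (L2_norm b * L2_norm a * nuclear_sum xi eta)%:E)%E.
Proof.
move=> nA; have mk (k : 'I_n) : measurable_fun setT
    (fun p => (normc (pairing b a (kernel2 (xi k) (eta k)) p))%:E).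
  apply/measurable_EFinP/measurable_normc/cmeasurable_pairing;
    do ?[exact: cmeasurable_L2|exact: cmeasurable_kernel2_L2].
rewrite (eq_integral (fun p => \sum_(k < n)
    (normc (pairing b a (kernel2 (xi k) (eta k)) p))%:E)); last first.
  move=> p _; rewrite sumEFin; congr EFin.
  rewrite /kernel_abs_sum mulr_sumr mulr_suml; apply: eq_bigr => k _.
  by rewrite normc_pairing.
rewrite ge0_integral_sum//; last by move=> k p _; rewrite lee_fin normc_ge0.
apply: (@le_trans _ _ (\sum_(k < n) (L2_norm b * L2_norm a *
    (L2_norm (xi k) * L2_norm (eta k)))%:E)).
  apply: lee_sum => k _; apply: le_trans (integral_pairing_kernel2 _ _ _ _) _.
  rewrite lee_fin le_eqVlt; apply/orP; left; apply/eqP.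
  move: (L2_norm (xi k)) (L2_norm b) (L2_norm (eta k)) (L2_norm a) => ? ? ? ?.
  by ring.
rewrite sumEFin lee_fin -mulr_sumr; apply: ler_wpM2l.
  by rewrite mulr_ge0 ?L2_norm_ge0.
by have := series_nuclear_le n nA; rewrite /series/= big_mkord.
Qed.

(** Paired with the positive weight, the sums of absolute values have bounded
    integrals, so they are bounded at almost every point. *)
Lemma kernel_sum_cvg (A : S1 R) xi eta : nuclear_series A xi eta ->
  {ae nu, forall p, exists w, ccvg (kernel_sum xi eta ^~ p) w}.
Proof.
move=> nA; pose W := weighted_set [set: RR].
pose g n p := normc (W p.1) * kernel_abs_sum xi eta n p * normc (W p.2).
have mW : measurable_fun setT (fun t => normc (W t)) by exact/measurable_normc/cmeasurable_L2.
have mg n : measurable_fun setT (g n).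
  apply: measurable_funM; last exact: (measurableT_comp mW measurable_snd).
  apply: measurable_funM; first exact: (measurableT_comp mW measurable_fst).
  exact: measurable_kernel_abs_sum.
have ndg p : nondecreasing_seq (g ^~ p).
  move=> m n mn; rewrite /g ler_wpM2r ?normc_ge0// ler_wpM2l ?normc_ge0//.
  exact: kernel_abs_sum_nd.
have g0 n p : 0 <= g n p by rewrite !mulr_ge0 ?normc_ge0 ?kernel_abs_sum_ge0.
have [G iG gG] := monotone_dominating mg ndg g0
  (fun n => integral_pairing_abs_sum n W W nA).
have WE : {ae mu, forall t : RR, 0 < normc (W t)}.
  apply: filterS2 (weighted_set_ae (@measurableT _ RR)) (haar_ae_neq (0 : R)) => t -> t0.
  by rewrite indicT mul1r normc_real normr_gt0 gt_eqF// weight_gt0.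
apply: filterS3 (haar2_ae_fst WE) (haar2_ae_snd WE) (integrable_ae measurableT iG) => p W1 W2 /(_ I) Gp.
apply: (@ccvg_absolute _ (fun k => kernel2 (xi k) (eta k) p) (fine (G p) / normc (W p.1) / normc (W p.2))) => n.
rewrite ler_pdivlMr// ler_pdivlMr// -lee_fin fineK//.
by apply: le_trans (gG n p); rewrite lee_fin /g /kernel_abs_sum; lra.
Qed.

(** The partial sums of a nuclear series represent the kernel pointwise: they
    converge almost everywhere, and dominated convergence shows that their limit
    has the same matrix coefficients as the operator. *)
Lemma kernel_series (A : S1 R) K xi eta : is_kernel A K ->
  nuclear_series A xi eta ->
  {ae nu, forall p, ccvg (kernel_sum xi eta ^~ p) (K p)}.
Proof.
move=> hK nA.
have [K' mK' cvK'] := ae_limit (cmeasurable_kernel_sum xi eta) (kernel_sum_cvg nA).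
have dct a b : cintegrable nu (pairing b a K') /\
    ccvg (fun n => cintegral nu (pairing b a (kernel_sum xi eta n)))
      (cintegral nu (pairing b a K')).
  have ma : measurable_fun setT (fun t => normc (a t)) by exact/measurable_normc/cmeasurable_L2.
  have mb : measurable_fun setT (fun t => normc (b t)) by exact/measurable_normc/cmeasurable_L2.
  apply: (@cvg_cintegral _ _ _ nu _ _
    (fun n p => normc (b p.1) * kernel_abs_sum xi eta n p * normc (a p.2))
    (L2_norm b * L2_norm a * nuclear_sum xi eta)).
  - move=> n; apply: cmeasurable_pairing;
      do ?[exact: cmeasurable_L2|exact: cmeasurable_kernel_sum].
  - by apply: cmeasurable_pairing => //; exact: cmeasurable_L2.
  - move=> n; apply: measurable_funM; last exact: (measurableT_comp ma measurable_snd).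
    apply: measurable_funM; first exact: (measurableT_comp mb measurable_fst).
    exact: measurable_kernel_abs_sum.
  - move=> p m n mn; rewrite ler_wpM2r ?normc_ge0// ler_wpM2l ?normc_ge0//.
    exact: kernel_abs_sum_nd.
  - move=> n p; rewrite normc_pairing.
    by rewrite ler_wpM2r ?normc_ge0// ler_wpM2l ?normc_ge0// kernel_sum_le.
  - by move=> n; exact: integral_pairing_abs_sum nA.
  - apply: filterS cvK' => p Kp; apply: ccvgM; last exact: ccvg_cst.
    by apply: ccvgM => //; exact: ccvg_cst.
suff KK' : {ae nu, forall p, K p = K' p}.
  by apply: filterS2 KK' cvK' => p ->.
have sK := is_kernel_square_integrable hK.
apply: kernel_unique => //.
- by case: sK.
- by move=> a b; exact: cintegrable_pairing.
- by move=> a b; case: (dct a b).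
- move=> a b; have [_ cv] := dct a b.
  rewrite -(is_kernel_coefficient a b hK).
  apply: ccvg_unique (coefficient_nuclear a b nA) _.
  rewrite (_ : (fun n => _) = fun n => cintegral nu (pairing b a (kernel_sum xi eta n)))//.
  apply/funext => n; have -> : pairing b a (kernel_sum xi eta n) =
      (fun p => \sum_(k < n) pairing b a (kernel2 (xi k) (eta k)) p).
    by apply/funext => p; rewrite pairing_sum.
  rewrite cintegral_sum; last first.
    move=> k; split; last first.
      exact: le_lt_trans (integral_pairing_kernel2 _ _ _ _) (ltry _).
    by apply: cmeasurable_pairing;
      do ?[exact: cmeasurable_L2|exact: cmeasurable_kernel2_L2].
  by apply: eq_bigr => k _; rewrite coefficient_tensorE.
Qed.

End KernelSeries.

(** * The kernel of a dual convolution *)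

Section BoxCoefficients.
Variable R : realType.
Local Notation RR := (measurableTypeR R).
Local Notation mu := (haar R).
Local Notation nu := (haar2 R).
Implicit Types x y a b : L2Rx R.

(** Bilinearity and the norm bound give convergence of the double series:
    the remainder splits into three dual convolutions with a small factor. *)
Lemma coefficient_box_series (box : {bilinear S1 R -> S1 R -> S1 R})
    (hbox : dual_convolution box) (A B : S1 R) xi eta xi' eta' a b :
  nuclear_series A xi eta -> nuclear_series B xi' eta' ->
  ccvg (fun n => \sum_(j < n) \sum_(k < n)
      coefficient a b (box (tensor (xi j) (eta j)) (tensor (xi' k) (eta' k))))
    (coefficient a b (box A B)).
Proof.
move=> nA nB; pose An n := \sum_(j < n) tensor (xi j) (eta j) : S1 R.
pose Bn n := \sum_(k < n) tensor (xi' k) (eta' k) : S1 R.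
have tA : trace_norm (A - An n) @[n --> \oo] --> (0 : R) := nuclear_tail nA.
have tB : trace_norm (B - Bn n) @[n --> \oo] --> (0 : R) := nuclear_tail nB.
pose c := 4 * (L2_norm a * L2_norm b).
have c0 : 0 <= c by rewrite !mulr_ge0 ?L2_norm_ge0.
have box_le (C D : S1 R) : normc (coefficient a b (box C D)) <=
    c * (trace_norm C * trace_norm D).
  by apply: le_trans (coefficient_le _ _ _) _; rewrite ler_wpM2l// hbox.1.
rewrite (_ : (fun n => _) = fun n => coefficient a b (box (An n) (Bn n))); last first.
  apply/funext => n; rewrite /An /Bn linear_sumlz coefficient_sum.
  by apply: eq_bigr => j _; rewrite linear_sumr coefficient_sum.
pose e n := c * (trace_norm (A - An n) * trace_norm B +
  trace_norm A * trace_norm (B - Bn n) + trace_norm (A - An n) * trace_norm (B - Bn n)).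
apply: (@ccvg_bounded _ _ _ e) => [n|].
  have split3 : coefficient a b (box A B) - coefficient a b (box (An n) (Bn n)) =
      coefficient a b (box (A - An n) B) + coefficient a b (box A (B - Bn n)) -
      coefficient a b (box (A - An n) (B - Bn n)).
    have lB C C' D : box (C - C') D = box C D - box C' D by exact: linearBl.
    have rB C D D' : box C (D - D') = box C D - box C D' by exact: linearBr.
    have -> : box (A - An n) B = _ := lB A (An n) B.
    have -> : box A (B - Bn n) = _ := rB A B (Bn n).
    have -> : box (A - An n) (B - Bn n) = _ := lB A (An n) (B - Bn n).
    have -> : box A (B - Bn n) = _ := rB A B (Bn n).
    have -> : box (An n) (B - Bn n) = _ := rB (An n) B (Bn n).
    rewrite !coefficientB; ring.
  rewrite -normc_opp opprB split3.
  apply: le_trans (normc_triangle _ _) _; rewrite normc_opp.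
  rewrite /e !mulrDr; apply: lerD => //.
  by apply: le_trans (normc_triangle _ _) _; apply: lerD.
rewrite -[X in _ --> X](mulr0 c); apply: cvgMr.
have cv0 (u v : nat -> R) (s t : R) : u n @[n --> \oo] --> (0 : R) ->
    v n @[n --> \oo] --> (0 : R) ->
    u n * t + s * v n + u n * v n @[n --> \oo] --> (0 : R).
  move=> u0 v0; rewrite [X in _ --> X](_ : _ = 0 * t + s * 0 + 0 * 0); last first.
    by rewrite !mul0r mulr0 !addr0.
  by apply: cvgD; [apply: cvgD; [exact: cvgMl|exact: cvgMr]|exact: cvgM].
exact: (cv0 _ _ _ _ tA tB).
Qed.

Lemma paired_twist_sum (b a : RR -> R[i]) xi eta xi' eta' n q :
  paired_twist b a (@kernel_sum R xi eta n) (kernel_sum xi' eta' n) q =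
  \sum_(j < n) \sum_(k < n)
    paired_twist b a (kernel2 (xi j) (eta j)) (kernel2 (xi' k) (eta' k)) q.
Proof.
rewrite /paired_twist /pairing /twist /kernel_sum big_distrlr mulr_sumr mulr_suml.
by apply: eq_bigr => j _; rewrite mulr_sumr mulr_suml.
Qed.

Lemma normc_paired_twist (b a : RR -> R[i]) (K1 K2 : RR * RR -> R[i]) q :
  normc (paired_twist b a K1 K2 q) = normc (b q.2.1) *
  (normc (K1 (q.2.1 / (1 + q.1), q.2.2 / (1 + q.1))) *
   normc (K2 (q.1 * q.2.1 / (1 + q.1), q.1 * q.2.2 / (1 + q.1)))) * normc (a q.2.2).
Proof. by rewrite /paired_twist normc_pairing /twist Normc.normcM. Qed.

(** Dominated convergence for the partial sums of both kernels.  A null set in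
    the plane is avoided by almost every pair of arguments because, for fixed h,
    the two dilations preserve the Haar measure. *)
Lemma paired_twist_kernels (box : {bilinear S1 R -> S1 R -> S1 R})
    (hbox : dual_convolution box) (A B : S1 R) (K1 K2 : RR * RR -> R[i]) a b :
  is_kernel A K1 -> is_kernel B K2 ->
  cintegrable (mu \x nu)%E (paired_twist b a K1 K2) /\
  cintegral (mu \x nu)%E (paired_twist b a K1 K2) = coefficient a b (box A B).
Proof.
move=> hA hB.
have /asboolP [xi [eta nA]] := trace_classP A.
have /asboolP [xi' [eta' nB]] := trace_classP B.
have [mK1 _] := is_kernel_square_integrable hA.
have [mK2 _] := is_kernel_square_integrable hB.
pose sg (q : RR * (RR * RR)) : RR * RR := (q.2.1 / (1 + q.1), q.2.2 / (1 + q.1)).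
pose tau (q : RR * (RR * RR)) : RR * RR :=
  (q.1 * q.2.1 / (1 + q.1), q.1 * q.2.2 / (1 + q.1)).
have msg : measurable_fun setT sg := @measurable_dilate2 R.
have mtau : measurable_fun setT tau := @measurable_codilate2 R.
have sgK : {ae (mu \x nu)%E, forall q, ccvg (fun n => kernel_sum xi eta n (sg q)) (K1 (sg q))}.
  apply: (skew_ae msg _ (kernel_series hA nA)).
  apply: filterS (haar_ae_neq (-1 : R)) => h /neq0_onep h0.
  rewrite (_ : (fun p => _) = (fun p : RR * RR => ((1 + h)^-1 * p.1, (1 + h)^-1 * p.2))).
    by apply: haar2_scale; rewrite invr_eq0.
  by apply/funext => p; rewrite /sg/= ![_ / _]mulrC.
have tauK : {ae (mu \x nu)%E, forall q, ccvg (fun n => kernel_sum xi' eta' n (tau q)) (K2 (tau q))}.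
  apply: (skew_ae mtau _ (kernel_series hB nB)).
  apply: filterS2 (haar_ae_neq (-1 : R)) (haar_ae_neq (0 : R)) => h /neq0_onep h1 h0.
  rewrite (_ : (fun p => _) = (fun p : RR * RR => (h / (1 + h) * p.1, h / (1 + h) * p.2))).
    by apply: haar2_scale; rewrite mulf_neq0// invr_eq0.
  by apply/funext => p; rewrite /tau/=; congr pair; rewrite mulrAC.
have ma : measurable_fun setT (fun t => normc (a t)) by exact/measurable_normc/cmeasurable_L2.
have mb : measurable_fun setT (fun t => normc (b t)) by exact/measurable_normc/cmeasurable_L2.
pose g n q := normc (b q.2.1) * (kernel_abs_sum xi eta n (sg q) *
  kernel_abs_sum xi' eta' n (tau q)) * normc (a q.2.2).
pose M := L2_norm b * L2_norm a * nuclear_sum xi eta * nuclear_sum xi' eta'.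
have gM n : (\int[(mu \x nu)%E]_q (g n q)%:E <= M%:E)%E.
  rewrite (eq_integral (fun q => \sum_(j < n) \sum_(k < n)
     (normc (paired_twist b a (kernel2 (xi j) (eta j)) (kernel2 (xi' k) (eta' k)) q))%:E)); last first.
    move=> q _; rewrite /g /kernel_abs_sum big_distrlr mulr_sumr mulr_suml -sumEFin.
    apply: eq_bigr => j _; rewrite mulr_sumr mulr_suml -sumEFin.
    by apply: eq_bigr => k _; rewrite normc_paired_twist.
  have mt (j k : 'I_n) : measurable_fun setT (fun q =>
      (normc (paired_twist b a (kernel2 (xi j) (eta j)) (kernel2 (xi' k) (eta' k)) q))%:E).
    apply/measurable_EFinP/measurable_normc.
    exact: cmeasurable_integrable (cintegrable_paired_twist _ _ _ _ _ _).
  rewrite ge0_integral_sum//; last 2 first.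
  - by move=> j; exact: emeasurable_sum.
  - by move=> j q _; apply: sume_ge0 => k _; rewrite lee_fin normc_ge0.
  apply: (@le_trans _ _ (\sum_(j < n) \sum_(k < n) (L2_norm b * L2_norm a *
     ((L2_norm (xi j) * L2_norm (eta j)) * (L2_norm (xi' k) * L2_norm (eta' k))))%:E)).
    apply: lee_sum => j _; rewrite ge0_integral_sum//; last first.
      by move=> k q _; rewrite lee_fin normc_ge0.
    apply: lee_sum => k _; apply: le_trans (paired_twist_estimate _ _ _ _ _ _) _.
    rewrite lee_fin le_eqVlt; apply/orP; left; apply/eqP.
    move: (L2_norm (xi j)) (L2_norm (eta j)) (L2_norm (xi' k)) (L2_norm (eta' k)).
    by move: (L2_norm a) (L2_norm b) => ? ? ? ? ? ?; ring.
  have -> : \sum_(j < n) \sum_(k < n) (L2_norm b * L2_norm a *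
     ((L2_norm (xi j) * L2_norm (eta j)) * (L2_norm (xi' k) * L2_norm (eta' k))))%:E =
     (L2_norm b * L2_norm a * ((\sum_(j < n) L2_norm (xi j) * L2_norm (eta j)) *
      (\sum_(k < n) L2_norm (xi' k) * L2_norm (eta' k))))%:E.
    rewrite big_distrlr/= mulr_sumr -sumEFin; apply: eq_bigr => j _.
    by rewrite mulr_sumr -sumEFin.
  have s0 (u v : nat -> L2Rx R) : 0 <= \sum_(j < n) L2_norm (u j) * L2_norm (v j).
    by apply: sumr_ge0 => j _; rewrite mulr_ge0 ?L2_norm_ge0.
  rewrite lee_fin /M -[leRHS]mulrA; apply: ler_wpM2l.
    by rewrite mulr_ge0 ?L2_norm_ge0.
  apply: ler_pM => //.
    by have := series_nuclear_le n nA; rewrite /series/= big_mkord.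
  by have := series_nuclear_le n nB; rewrite /series/= big_mkord.
have [it cvt] : cintegrable (mu \x nu)%E (paired_twist b a K1 K2) /\
  ccvg (fun n => cintegral (mu \x nu)%E
      (paired_twist b a (kernel_sum xi eta n) (kernel_sum xi' eta' n)))
    (cintegral (mu \x nu)%E (paired_twist b a K1 K2)).
  apply: (@cvg_cintegral _ _ _ (mu \x nu)%E _ _ g M).
  - move=> n; apply: cmeasurable_paired_twist;
      do ?[exact: cmeasurable_L2|exact: cmeasurable_kernel_sum].
  - by apply: cmeasurable_paired_twist => //; exact: cmeasurable_L2.
  - move=> n; apply: measurable_funM; last first.
      exact: (measurableT_comp ma (measurableT_comp measurable_snd measurable_snd)).
    apply: measurable_funM.
      exact: (measurableT_comp mb (measurableT_comp measurable_fst measurable_snd)).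
    apply: measurable_funM.
      exact: (measurableT_comp (measurable_kernel_abs_sum xi eta n) msg).
    exact: (measurableT_comp (measurable_kernel_abs_sum xi' eta' n) mtau).
  - move=> q m n mn; rewrite /g ler_wpM2r ?normc_ge0// ler_wpM2l ?normc_ge0//.
    by apply: ler_pM; rewrite ?kernel_abs_sum_ge0//; exact: kernel_abs_sum_nd.
  - move=> n q; rewrite normc_paired_twist /g ler_wpM2r ?normc_ge0// ler_wpM2l ?normc_ge0//.
    by apply: ler_pM; rewrite ?normc_ge0// kernel_sum_le.
  - exact: gM.
  - apply: filterS2 sgK tauK => q c1 c2; apply: ccvgM; last exact: ccvg_cst.
    by apply: ccvgM; [exact: ccvg_cst|exact: ccvgM c1 c2].
split => //; apply: ccvg_unique cvt _.
rewrite (_ : (fun n => _) = fun n => \sum_(j < n) \sum_(k < n)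
    coefficient a b (box (tensor (xi j) (eta j)) (tensor (xi' k) (eta' k)))).
  exact: coefficient_box_series.
apply/funext => n.
have -> : paired_twist b a (kernel_sum xi eta n) (kernel_sum xi' eta' n) =
    (fun q => \sum_(j < n) \sum_(k < n)
      paired_twist b a (kernel2 (xi j) (eta j)) (kernel2 (xi' k) (eta' k)) q).
  by apply/funext => q; exact: paired_twist_sum.
rewrite cintegral_sum; last first.
  by move=> j; apply: cintegrable_sum => k; exact: cintegrable_paired_twist.
apply: eq_bigr => j _; rewrite cintegral_sum; last by move=> k; exact: cintegrable_paired_twist.
by apply: eq_bigr => k _; rewrite (coefficient_box_tensor hbox).
Qed.

Lemma paired_twist_section (b a : RR -> R[i]) (K1 K2 : RR * RR -> R[i]) p :
  (fun h => paired_twist b a K1 K2 (h, p)) =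
  (fun h => ((b p.1)^* * a p.2) * twist K1 K2 (h, p)).
Proof. by apply/funext => h; rewrite /paired_twist /pairing mulrAC. Qed.

(** By Fubini the integral in h has the matrix coefficients of the dual
    convolution, so it is its kernel.  Integrability in h at almost every point is
    read off from one pairing with functions that vanish almost nowhere. *)
Lemma box_kernel (box : {bilinear S1 R -> S1 R -> S1 R})
    (hbox : dual_convolution box) (A B : S1 R) (K1 K2 K : RR * RR -> R[i]) :
  is_kernel A K1 -> is_kernel B K2 -> is_kernel (box A B) K ->
  {ae nu, forall p, cintegrable mu (fun h => twist K1 K2 (h, p)) /\
    K p = cintegral mu (fun h => twist K1 K2 (h, p))}.
Proof.
move=> hA hB hK.
have [mK1 _] := is_kernel_square_integrable hA.
have [mK2 _] := is_kernel_square_integrable hB.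
have mT := cmeasurable_twist mK1 mK2.
have sec p : cmeasurable (fun h => twist K1 K2 (h, p)).
  by apply: (cmeasurable_comp (pair2_measurable p) mT).
have fub a b := cintegral_fubini_swap (paired_twist_kernels hbox a b hA hB).1.
have iT : {ae nu, forall p, cintegrable mu (fun h => twist K1 K2 (h, p))}.
  pose W := weighted_set [set: RR].
  have WE : {ae mu, forall t : RR, W t != 0}.
    apply: filterS2 (weighted_set_ae (@measurableT _ RR)) (haar_ae_neq (0 : R)) => t -> t0.
    by rewrite indicT mul1r fmorph_eq0 gt_eqF// weight_gt0.
  have [ai _ _ _] := fub W W.
  apply: filterS3 (haar2_ae_fst WE) (haar2_ae_snd WE) ai => p W1 W2.
  rewrite paired_twist_section; set c := (_ * _) => /(cintegrableZ c^-1).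
  rewrite (_ : (fun h => _) = fun h => twist K1 K2 (h, p))//.
  apply/funext => h; rewrite mulrA mulVf ?mul1r//.
  by rewrite mulf_neq0// fmorph_eq0.
pose Phi p := cintegral mu (fun h => twist K1 K2 (h, p)).
have mPhi : cmeasurable Phi := cmeasurable_cintegral_param mu mT.
have pE a b : {ae nu, forall p, cintegral mu (fun h => paired_twist b a K1 K2 (h, p)) =
    pairing b a Phi p}.
  apply: filterS iT => p ip; rewrite paired_twist_section cintegralZ//.
  by rewrite /pairing mulrAC.
have mp a b : cmeasurable (pairing b a Phi).
  by apply: cmeasurable_pairing => //; exact: cmeasurable_L2.
suff KPhi : {ae nu, forall p, K p = Phi p} by apply: filterS2 iT KPhi.
have sK := is_kernel_square_integrable hK.
apply: kernel_unique => //.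
- by case: sK.
- by move=> a b; exact: cintegrable_pairing.
- move=> a b; have [_ _ fi _] := fub a b.
  exact: ae_cintegrable (mp a b) (pE a b) fi.
- move=> a b; have [_ fm _ fE] := fub a b.
  rewrite -(is_kernel_coefficient a b hK) -(paired_twist_kernels hbox a b hA hB).2 fE.
  exact: ae_eq_cintegral fm (mp a b) (pE a b).
Qed.

End BoxCoefficients.

(** * The two integral formulas *)

Section ConvexForm.
Variable R : realType.
Local Notation RR := (measurableTypeR R).
Local Notation leb := (@lebesgue_measure R).

Definition fraction_form (K1 K2 : RR * RR -> R[i]) (s t : R) (h : RR) : R[i] :=
  K1 (s / (1 + h), t / (1 + h)) * K2 (h * s / (1 + h), h * t / (1 + h)) / (`|h|)%:C.

Definition convex_form (K1 K2 : RR * RR -> R[i]) (s t : R) (u : RR) : R[i] :=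
  K1 ((1 - u) * s, (1 - u) * t) * K2 (u * s, u * t) / (`|1 - u| * `|u|)%:C.

Lemma cmeasurable_convex_form K1 K2 s t : cmeasurable K1 -> cmeasurable K2 ->
  cmeasurable (convex_form K1 K2 s t).
Proof.
move=> m1 m2.
have mo : measurable_fun setT (fun u : RR => 1 - u : RR) by exact: measurable_funB.
have mul (c : R) (f : RR -> RR) : measurable_fun setT f ->
    measurable_fun setT (fun u : RR => f u * c : RR) by move=> mf; exact: measurable_funM.
apply: cmeasurableM; first apply: cmeasurableM.
- apply: (cmeasurable_comp (phi := fun u : RR => ((1 - u) * s, (1 - u) * t) : RR * RR)) m1.
  by apply: measurable_fun_pair; exact: mul.
- apply: (cmeasurable_comp (phi := fun u : RR => (u * s, u * t) : RR * RR)) m2.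
  by apply: measurable_fun_pair; exact: mul.
rewrite (_ : (fun u => _) = fun u : RR => ((`|1 - u| * `|u|)^-1)%:C); last first.
  by apply/funext => u; rewrite fmorphV.
apply: cmeasurable_real; apply: (measurableT_comp (@measurable_invr R)).
apply: measurable_funM; last exact: normr_measurable.
by apply: (measurableT_comp (@normr_measurable R setT)).
Qed.

(** With h = u / (1 - u) one has 1 + h = 1 / (1 - u), and the Jacobian
    1 / (1 - u)^2 turns dh / |h| into du / (|1 - u| |u|). *)
Lemma moebius_convex_form K1 K2 s t (u : RR) : u != 0 -> u != 1 ->
  fraction_form K1 K2 s t ((1 - u)^-1 - 1) * (`|1 - u|^-1 * `|1 - u|^-1)%:C =
  convex_form K1 K2 s t u.
Proof.
move=> u0 u1; have v0 : 1 - u != 0 by rewrite subr_eq0 eq_sym.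
rewrite /fraction_form /convex_form.
have hE : (1 - u)^-1 - 1 = u / (1 - u) by field.
have opE : 1 + ((1 - u)^-1 - 1) = (1 - u)^-1 by rewrite addrC subrK.
rewrite opE invrK hE.
have arg (x : R) : u / (1 - u) * x * (1 - u) = u * x by field.
rewrite !arg ![_ * (1 - u)]mulrC -!mulrA; congr (_ * (_ * _)).
rewrite -!fmorphV -rmorphM; congr (_%:C).
rewrite normrM normfV; field.
by rewrite !normr_eq0 u0 v0.
Qed.

End ConvexForm.

Theorem proposition3p7 (R : realType)
    (box : {bilinear S1 R -> S1 R -> S1 R}) (hbox : dual_convolution box)
    (T1 T2 : S1 R) (K1 K2 K : measurableTypeR R * measurableTypeR R -> R[i])
    (hK1 : is_kernel T1 K1) (hK2 : is_kernel T2 K2)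
    (hK : is_kernel (box T1 T2) K) :
  {ae (haar R \x haar R)%E, forall st : measurableTypeR R * measurableTypeR R,
    let s : R := st.1 in
    let t : R := st.2 in
    let F := fun h : measurableTypeR R =>
      K1 (s / (1 + h), t / (1 + h)) * K2 (h * s / (1 + h), h * t / (1 + h))
        / (`|h|)%:C in
    let G := fun u : measurableTypeR R =>
      K1 ((1 - u) * s, (1 - u) * t) * K2 (u * s, u * t)
        / (`|1 - u| * `|u|)%:C in
    [/\ cintegrable lebesgue_measure F,
        cintegrable lebesgue_measure G,
        K (s, t) = cintegral lebesgue_measure F
      & cintegral lebesgue_measure F = cintegral lebesgue_measure G]}.
Proof.
have [mK1 _] := is_kernel_square_integrable hK1.
have [mK2 _] := is_kernel_square_integrable hK2.
have main : {ae haar2 R, forall p, cintegrable (haar R) (fun h => twist K1 K2 (h, p)) /\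
    K p = cintegral (haar R) (fun h => twist K1 K2 (h, p))}.
  exact: (box_kernel hbox hK1 hK2 hK).
apply: filterS main => -[s t] [iT KE] /=.
rewrite -/(fraction_form K1 K2 s t) -/(convex_form K1 K2 s t).
have mT := cmeasurable_integrable iT.
have FE : fraction_form K1 K2 s t = fun h => twist K1 K2 (h, (s, t)) * (`|h|^-1)%:C.
  by apply/funext => h; rewrite /fraction_form /twist fmorphV.
have iF : cintegrable lebesgue_measure (fraction_form K1 K2 s t).
  by rewrite FE; exact: (haar_cintegrableP mT).2.
have [iM FM] := lebesgue_moebius iF.
have mG := cmeasurable_convex_form s t mK1 mK2.
have MG : {ae lebesgue_measure, forall u,
    fraction_form K1 K2 s t ((1 - u)^-1 - 1) * (`|1 - u|^-1 * `|1 - u|^-1)%:C =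
    convex_form K1 K2 s t u}.
  by apply: filterS2 (ae_neq (0 : R)) (ae_neq (1 : R)) => u; exact: moebius_convex_form.
split => //.
- exact: ae_cintegrable mG MG iM.
- by rewrite KE haar_cintegral// -FE.
- by rewrite FM; exact: ae_eq_cintegral (cmeasurable_integrable iM) mG MG.
Qed.
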